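(* Let $(X,g)$ be a multi-Eguchi--Hanson or a multi-Taub--NUT space with singular points $p_1,\dots,p_k$ of $\phi$. Then every compact minimal submanifold of $X$ is contained in $$\pi^{-1}\Big(\{x\in\mathbb{R}^3: |x|\le C\max_i|p_i|\}\Big),$$ where $C\approx 5.07$ is the only real root of the polynomial $-x^3+4x^2+5x+2$. Moreover, if $p_i=0$ for some $i$, then there exists $r_0>0$ (small enough) such that there are no compact minimal submanifolds contained in $\pi^{-1}(\{x\in\mathbb{R}^3:|x|<r_0\})$.
   Context: Multi-Eguchi--Hanson and multi-Taub--NUT spaces: let $p_1,\dots,p_k$ be distinct points of $\mathbb{R}^3$ ($k\ge 1$), let $m\ge 0$, let $U=\mathbb{R}^3\setminus\{p_1,\dots,p_k\}$, and let $\phi(x)=m+\sum_{i=1}^k \frac{1}{2|x-p_i|}$ on $U$. Let $\pi:X_0\to U$ be the principal $S^1$-bundle (with $S^1=\mathbb{R}/2\pi\mathbb{Z}$) carrying a connection $1$-form $\eta$ (that is, $\eta$ is $S^1$-invariant and $\eta(\xi)=1$, with $\xi$ the infinitesimal generator of the action) such that $d\eta=\pi^*( *_{\mathbb{R}^3}d\phi)$, and put $g=\phi^{-1}\eta^2+\phi\,\pi^*g_{\mathbb{R}^3}$. Adding one point over each $p_i$ yields a smooth complete hyperkähler $4$-manifold $(X,g)$ to which the $S^1$-action extends (fixing the added points), and $\pi$ extends to $\pi:X\to\mathbb{R}^3$. It is called a multi-Eguchi--Hanson space if $m=0$ and a multi-Taub--NUT space if $m>0$; the $p_i$ are called the singular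 points of $\phi$. $|\cdot|$ is the Euclidean norm on $\mathbb{R}^3$. Submanifolds are without boundary and have dimension between $1$ and $3$; minimal means vanishing mean curvature vector. *)

(* Defs.v *)
From HB Require Import structures.
From mathcomp Require Import all_boot all_order all_algebra.
From mathcomp Require Import all_classical all_reals all_analysis.
Set Implicit Arguments.
Unset Strict Implicit.
Unset Printing Implicit Defensive.
Import Order.TTheory GRing.Theory Num.Theory.
Import numFieldNormedType.Exports.
Local Open Scope classical_set_scope.
Local Open Scope ring_scope.

(* Points and vectors of R^n are row vectors ['rV[R]_n].  Matrices act on the
   right, so [jacobian f z] has the partial derivatives of [f] as its rows. *)

Definition enorm (R : realType) (n : nat) (x : 'rV[R]_n) : R :=
  Num.sqrt (\sum_(i < n) x 0 i ^+ 2).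

Definition partial (R : realType) (n : nat) (W : normedModType R) (i : 'I_n)
    (f : 'rV[R]_n -> W) : 'rV[R]_n -> W :=
  fun z => 'D_(delta_mx 0 i) f z.

Definition iter_derive (R : realType) (V W : normedModType R) (s : seq V)
    (f : V -> W) : V -> W :=
  foldr (fun v h => fun x => 'D_v h x) f s.

(* C^infinity on a neighbourhood of x: iterated directional derivatives of all
   orders are Frechet differentiable there. *)
Definition smooth_at (R : realType) (V W : normedModType R) (f : V -> W)
    (x : V) : Prop :=
  \forall y \near x, forall s : seq V, differentiable (iter_derive s f) y.

(* [cmap] and [cinv] are total functions; only their restrictions to [cdom] and
   [cmap @` cdom] are meaningful. *)
Record chart (R : realType) (T : topologicalType) (n : nat) := Chart {
  cdom : set T;
  cmap : T -> 'rV[R]_n;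
  cinv : 'rV[R]_n -> T;
  cdom_open : open cdom;
  cimage_open : open (cmap @` cdom);
  cmapK : forall p, cdom p -> cinv (cmap p) = p;
  cmap_continuous : forall p, cdom p -> {for p, continuous cmap};
  cinv_continuous : forall p, cdom p -> {for cmap p, continuous cinv}
}.

(* The atlas is not required to be maximal. *)
Record smoothManifold (R : realType) (n : nat) := SmoothManifold {
  carrier :> topologicalType;
  atlas : set (chart R carrier n);
  manifold_hausdorff : hausdorff_space carrier;
  manifold_second_countable : @second_countable carrier;
  atlas_cover : forall p : carrier, exists2 c, atlas c & cdom c p;
  atlas_compatible : forall c c' (p : carrier), atlas c -> atlas c' ->
    cdom c p -> cdom c' p -> smooth_at (cmap c' \o cinv c) (cmap c p)
}.

Definition chart_at (R : realType) (n : nat) (M : smoothManifold R n)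
    (c : chart R M n) (p : M) : Prop := atlas c /\ cdom c p.

Definition smooth_fun_at (R : realType) (n : nat) (M : smoothManifold R n)
    (W : normedModType R) (f : M -> W) (p : M) : Prop :=
  forall c, chart_at c p -> smooth_at (f \o cinv c) (cmap c p).

Definition smooth_into_at (R : realType) (n : nat) (M : smoothManifold R n)
    (V : normedModType R) (f : V -> M) (v : V) : Prop :=
  {for v, continuous f} /\
  forall c, chart_at c (f v) -> smooth_at (cmap c \o f) v.

Definition in_charts (R : realType) (d n : nat) (N : smoothManifold R d)
    (M : smoothManifold R n) (F : N -> M) (a : chart R N d) (c : chart R M n) :
    'rV[R]_d -> 'rV[R]_n := cmap c \o F \o cinv a.

Definition smooth_map (R : realType) (d n : nat) (N : smoothManifold R d)
    (M : smoothManifold R n) (F : N -> M) : Prop :=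
  continuous F /\
  forall q a c, chart_at a q -> chart_at c (F q) ->
    smooth_at (in_charts F a c) (cmap a q).

Definition immersion (R : realType) (d n : nat) (N : smoothManifold R d)
    (M : smoothManifold R n) (F : N -> M) : Prop :=
  smooth_map F /\
  forall q a c, chart_at a q -> chart_at c (F q) ->
    \rank (jacobian (in_charts F a c) (cmap a q)) = d.

(* Tensor fields are given by their components in each chart, as functions of
   the coordinates. *)
Definition oneForm (R : realType) (n : nat) (M : smoothManifold R n) : Type :=
  chart R M n -> 'rV[R]_n -> 'cV[R]_n.

Definition bilinField (R : realType) (n : nat) (M : smoothManifold R n) : Type :=
  chart R M n -> 'rV[R]_n -> 'M[R]_n.

(* h^* eta = eta at the points of A.  For h = id this is the transformation law
   of the components of eta under changes of charts. *)
Definition preserves_form (R : realType) (n : nat) (M : smoothManifold R n)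
    (A : set M) (eta : oneForm M) (h : M -> M) : Prop :=
  forall p c c', A p -> chart_at c p -> chart_at c' (h p) ->
    eta c (cmap c p) =
    jacobian (in_charts h c c') (cmap c p) *m eta c' (cmap c' (h p)).

Definition smooth_form_on (R : realType) (n : nat) (M : smoothManifold R n)
    (A : set M) (eta : oneForm M) : Prop :=
  (forall p c, A p -> chart_at c p -> smooth_at (eta c) (cmap c p)) /\
  preserves_form A eta id.

(* (d eta)_ij = d_i eta_j - d_j eta_i *)
Definition dform (R : realType) (n : nat) (eta : 'rV[R]_n -> 'cV[R]_n)
    (z : 'rV[R]_n) : 'M[R]_n :=
  \matrix_(i, j) (partial i eta z j 0 - partial j eta z i 0).

Definition riemannian_metric (R : realType) (n : nat) (M : smoothManifold R n)
    (g : bilinField M) : Prop :=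
  [/\ forall p c, chart_at c p -> smooth_at (g c) (cmap c p),
      forall p c c', chart_at c p -> chart_at c' p ->
        let J := jacobian (in_charts id c c') (cmap c p) in
        g c (cmap c p) = J *m g c' (cmap c' p) *m J^T,
      forall p c, chart_at c p -> (g c (cmap c p))^T = g c (cmap c p)
    & forall p c (v : 'rV[R]_n), chart_at c p -> v != 0 ->
        0 < (v *m g c (cmap c p) *m v^T) 0 0].

(* [f : R^d -> R^n] is the coordinate expression of the immersion and [G] the
   matrix of the ambient metric. *)
Section MeanCurvature.
Variables (R : realType) (d n : nat) (G : 'rV[R]_n -> 'M[R]_n).

(* Levi-Civita connection: the vector nabla_{d_i} d_j, with components
   Gamma^a_ij *)
Definition christoffel (z : 'rV[R]_n) (i j : 'I_n) : 'rV[R]_n :=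
  \row_a \sum_b 2^-1 * invmx (G z) a b *
    (partial i G z b j + partial j G z i b - partial b G z i j).

Variable f : 'rV[R]_d -> 'rV[R]_n.

Definition induced_metric (y : 'rV[R]_d) : 'M[R]_d :=
  jacobian f y *m G (f y) *m (jacobian f y)^T.

(* orthogonal projection, with respect to G, onto the image of df *)
Definition tangent_proj (y : 'rV[R]_d) (v : 'rV[R]_n) : 'rV[R]_n :=
  v *m G (f y) *m (jacobian f y)^T *m invmx (induced_metric y) *m jacobian f y.

(* nabla_{d_i f} (d_j f) *)
Definition cov_derive (y : 'rV[R]_d) (i j : 'I_d) : 'rV[R]_n :=
  partial i (partial j f) y +
  \sum_k \sum_l (partial i f y 0 k * partial j f y 0 l) *:
    christoffel (f y) k l.

Definition second_fundamental_form (y : 'rV[R]_d) (i j : 'I_d) : 'rV[R]_n :=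
  cov_derive y i j - tangent_proj y (cov_derive y i j).

Definition mean_curvature (y : 'rV[R]_d) : 'rV[R]_n :=
  \sum_i \sum_j invmx (induced_metric y) i j *: second_fundamental_form y i j.

End MeanCurvature.

(* A submanifold is the image of an immersion (an embedded submanifold being
   the image of its inclusion); manifolds have no boundary. *)
Definition minimal_immersion (R : realType) (d n : nat) (N : smoothManifold R d)
    (M : smoothManifold R n) (g : bilinField M) (F : N -> M) : Prop :=
  immersion F /\
  forall q a c, chart_at a q -> chart_at c (F q) ->
    mean_curvature (g c) (in_charts F a c) (cmap a q) = 0.

Definition compact_minimal_submanifold (R : realType) (d n : nat)
    (N : smoothManifold R d) (M : smoothManifold R n) (g : bilinField M)
    (F : N -> M) : Prop :=
  [/\ [set: N] !=set0, compact [set: N] & minimal_immersion g F].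

(* An action of S^1 = R / 2 pi Z is a 2 pi-periodic action of R. *)
Definition smooth_circle_action (R : realType) (n : nat)
    (M : smoothManifold R n) (act : R -> M -> M) : Prop :=
  [/\ forall p, act 0 p = p,
      forall s t p, act (s + t) p = act s (act t p),
      forall p, act (2 * pi) p = p
    & forall t p c, chart_at c p ->
        smooth_into_at (fun z : R * 'rV[R]_n => act z.1 (cinv c z.2))
          (t, cmap c p)].

(* the infinitesimal generator at p, in the coordinates of c *)
Definition generator (R : realType) (n : nat) (M : smoothManifold R n)
    (act : R -> M -> M) (c : chart R M n) (p : M) : 'rV[R]_n :=
  'D_1 (fun t : R => cmap c (act t p)) 0.

(* proj : proj^-1(U) -> U is a principal S^1-bundle.  A local trivialization
   over V is p |-> (proj p, u p), with u valued in the unit circle of R x R;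
   its inverse is (x, e^{it}) |-> Psi x t. *)
Definition principal_circle_bundle (R : realType) (n b : nat)
    (M : smoothManifold R n) (act : R -> M -> M) (proj : M -> 'rV[R]_b)
    (U : set 'rV[R]_b) : Prop :=
  (forall p, U (proj p) -> smooth_fun_at proj p) /\
  forall x0, U x0 ->
    exists (V : set 'rV[R]_b) (u : M -> R * R) (Psi : 'rV[R]_b -> R -> M),
    [/\ [/\ open V, V x0 & V `<=` U],
        forall p, V (proj p) ->
          smooth_fun_at u p /\ exists t, Psi (proj p) t = p,
        forall x t, V x ->
          smooth_into_at (fun z : 'rV[R]_b * R => Psi z.1 z.2) (x, t),
        forall x t, V x -> proj (Psi x t) = x /\ u (Psi x t) = (cos t, sin t)
      & forall x s t, V x -> act s (Psi x t) = Psi x (s + t)].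

Definition connection_form (R : realType) (n : nat) (M : smoothManifold R n)
    (act : R -> M -> M) (A : set M) (eta : oneForm M) : Prop :=
  [/\ smooth_form_on A eta,
      forall t, preserves_form A eta (act t)
    & forall p c, A p -> chart_at c p ->
        generator act c p *m eta c (cmap c p) = 1%:M].

Definition gh_potential (R : realType) (k : nat) (m : R) (p : 'I_k -> 'rV[R]_3)
    (x : 'rV[R]_3) : R :=
  m + \sum_(i < k) (2 * enorm (x - p i))^-1.

(* Matrix of the Hodge dual *w of a 1-form w on oriented Euclidean R^3:
   ( *w )_ab = sum_c eps_abc w_c.  Indices in ['I_3] are added modulo 3. *)
Definition hodge_star3 (R : realType) (w : 'I_3 -> R) : 'M[R]_3 :=
  \matrix_(a, b)
    if b == a + 1 then w (b + 1)
    else if a == b + 1 then - w (a + 1) else 0.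

Record ghSpace (R : realType) := GHSpace {
  gh_m : R;
  gh_k : nat;
  gh_p : 'I_gh_k -> 'rV[R]_3;
  gh_X :> smoothManifold R 4;
  gh_metric : bilinField gh_X;
  gh_act : R -> gh_X -> gh_X;
  gh_pi : gh_X -> 'rV[R]_3;
  gh_eta : oneForm gh_X;
  gh_U : set 'rV[R]_3 := [set x | forall i, x <> gh_p i];
  gh_X0 : set gh_X := gh_pi @^-1` gh_U;
  gh_phi : 'rV[R]_3 -> R := gh_potential gh_m gh_p;
  gh_m_ge0 : 0 <= gh_m;
  gh_k_gt0 : (0 < gh_k)%N;
  gh_p_inj : injective gh_p;
  gh_metricP : riemannian_metric gh_metric;
  gh_actP : smooth_circle_action gh_act;
  gh_pi_continuous : continuous gh_pi;
  gh_bundle : principal_circle_bundle gh_act gh_pi gh_U;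
  gh_etaP : connection_form gh_act gh_X0 gh_eta;
  (* exactly one point is added over each p_i, and it is fixed *)
  gh_added : forall i, exists2 q, gh_pi @^-1` [set gh_p i] = [set q] &
    forall t, gh_act t q = q;
  (* d eta = pi^* ( * d phi ) *)
  gh_monopole : forall q c, gh_X0 q -> chart_at c q ->
    let J := jacobian (gh_pi \o cinv c) (cmap c q) in
    dform (gh_eta c) (cmap c q) =
    J *m hodge_star3 (fun a => partial a gh_phi (gh_pi q)) *m J^T;
  (* g = phi^-1 eta^2 + phi pi^* g_{R^3} *)
  gh_metricE : forall q c, gh_X0 q -> chart_at c q ->
    let J := jacobian (gh_pi \o cinv c) (cmap c q) in
    let e := gh_eta c (cmap c q) in
    gh_metric c (cmap c q) =
    (gh_phi (gh_pi q))^-1 *: (e *m e^T) + gh_phi (gh_pi q) *: (J *m J^T)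
}.

Definition multi_Eguchi_Hanson (R : realType) (X : ghSpace R) : Prop :=
  gh_m X = 0.

Definition multi_Taub_NUT (R : realType) (X : ghSpace R) : Prop :=
  0 < gh_m X.

(* the norms are nonnegative and k >= 1, so the default value 0 is harmless *)
Definition max_norm_singular (R : realType) (X : ghSpace R) : R :=
  \big[Num.max/0]_(i < gh_k X) enorm (gh_p i).

(* Main.v *)
Require Import Defs.
From HB Require Import structures.
From mathcomp Require Import all_boot all_order all_algebra.
From mathcomp Require Import all_classical all_reals all_analysis.
From mathcomp Require Import ring lra.
Import Order.TTheory GRing.Theory Num.Theory.
Import numFieldNormedType.Exports.
Set Implicit Arguments.
Unset Strict Implicit.
Unset Printing Implicit Defensive.
Local Open Scope classical_set_scope.
Local Open Scope ring_scope.

(** Let h = |x|^2 o pi.  At a maximum point of h on a compact minimal submanifold,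
    the trace of the ambient Hessian of h over the tangent space is nonpositive,
    since the mean curvature term vanishes.  For v with alpha = eta(v) / phi and
    W = d pi(v), away from the added points,
      phi Hess h (v, v) = 2 phi |W|^2 - 2 alpha det(grad phi, W, x)
        - 2 <grad phi, W> <x, W> + <grad phi, x> (|W|^2 - alpha^2).
    This is linear in phi, so it splits as a sum over the poles p of phi.  By
    Cauchy-Schwarz and Hadamard the term of p is positive as soon as
    4 |p| < |x - p|, in particular when |x| > 5 max |p_i|; and near a pole at the
    origin the term of that pole, of size 1 / |x|, dominates all the others.
    A submanifold on which h vanishes identically lies over the origin alone,
    hence is a point. *)

(** * Directional derivatives *)

Section Derivatives.
Variable R : realType.

Lemma is_derive_diff (V W : normedModType R) (f : V -> W) y v :
  differentiable f y -> is_derive y v f ('d f y v).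
Proof. by move=> df; rewrite -deriveE//; exact/derivableP/diff_derivable. Qed.

Lemma is_derive_comp (U V W : normedModType R) (f : U -> V) (g : V -> W) y w :
  differentiable f y -> differentiable g (f y) ->
  is_derive y w (g \o f) ('D_('D_w f y) g (f y)).
Proof.
move=> df dg; have dc : differentiable (g \o f) y by exact: differentiable_comp.
apply: is_derive_eq (is_derive_diff w dc) _.
by rewrite diff_comp// !deriveE.
Qed.

Lemma is_derive_coord (V : normedModType R) m n (f : V -> 'M[R]_(m, n)) i j y v :
  derivable f y v -> is_derive y v (fun z => f z i j) ('D_v f y i j).
Proof.
move=> df; rewrite derive_mx// mxE; apply: derivableP.
by move/derivable_mxP: df.
Qed.

Lemma derive_sum_partial (W : normedModType R) n (f : 'rV[R]_n -> W) y v :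
  differentiable f y -> 'D_v f y = \sum_i v 0 i *: partial i f y.
Proof.
move=> df; rewrite /partial deriveE// {1}[v]row_sum_delta linear_sum /=.
by apply: eq_bigr => i _; rewrite linearZ deriveE.
Qed.

(** The difference [k] of the two functions vanishes near [x], so it is a little-o of anything and
    has zero differential; then [g] is [f + k]. *)
Lemma near_eq_differentiable (V W : normedModType R) (f g : V -> W) x :
  (\forall y \near x, f y = g y) -> differentiable f x -> differentiable g x.
Proof.
move=> fg df; pose k : V -> W := g - f.
have kE : k \o shift x = cst (k x) + (\0 : V -> W) +o_ 0 id.
  apply/eqaddoP => _/posnumP[e]; near=> y.
  have fgx := nbhs_singleton fg.
  rewrite !fctE /= /k !fctE fgx subrr addr0 subr0.
  suff -> : f (y + x) = g (y + x) by rewrite subrr normr0.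
  near: y; have := fg; rewrite (near_shift 0 x).
  by apply: filterS => z /=; rewrite subr0.
have dk : 'd k x = (\0 : {linear V -> W}) :> (V -> W).
  by apply: diff_unique => //; exact: cst_continuous.
have -> : g = f + k by rewrite /k addrC subrK.
apply: differentiableD => //; apply/diff_locallyP; rewrite dk; split => //.
exact: cst_continuous.
Unshelve. all: by end_near. Qed.

(** A pointwise form of being twice differentiable: the first derivatives exist near [x], but they
    are differentiable only at [x], with no continuity of the second ones. This suffices for
    symmetry of second derivatives and for second-order conditions at a maximum. *)
Definition C2_at (V W : normedModType R) (f : V -> W) (x : V) :=
  (\forall y \near x, differentiable f y) /\
  forall v, differentiable ('D_v f) x.

Lemma smooth_at_C2 (V W : normedModType R) (f : V -> W) x :
  smooth_at f x -> C2_at f x.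
Proof.
move=> sf; split.
  by apply: filterS sf => y /(_ [::]).
by move=> v; have /nbhs_singleton/(_ [:: v]) := sf.
Qed.

Lemma C2_at_coord (V : normedModType R) m n (f : V -> 'M[R]_(m, n)) i j x :
  C2_at f x -> C2_at (fun z => f z i j) x.
Proof.
move=> [df d2f]; have coordD M := @differentiable_coord R m n M i j.
split.
  apply: filterS df => y dfy.
  exact: (differentiable_comp dfy (coordD _)).
move=> v; have E : {near x, (fun z => 'D_v f z i j) =1 'D_v (fun z => f z i j)}.
  apply: filterS df => y dfy.
  by have /(_ v)[_ ->] := is_derive_coord i j (diff_derivable dfy).
apply: (near_eq_differentiable E).
exact: (differentiable_comp (d2f v) (coordD _)).
Qed.

Lemma is_derive_line (V W : normedModType R) (f : V -> W) (a v : V) (t : R) :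
  differentiable f (t *: v + a) ->
  is_derive t (1 : R) (fun s => f (s *: v + a)) ('D_v f (t *: v + a)).
Proof.
move=> df; have dl : differentiable (fun s : R => s *: v + a) t by exact: ex_diff.
apply: is_derive_eq (is_derive_comp _ dl df) _.
by rewrite (deriveE _ dl) diff_val !fctE /= scale1r addr0.
Qed.

(** Young's argument: the mean value theorem in the direction [v] reduces the second difference to a
    first difference of ['D_v f], and Frechet differentiability of ['D_v f] at [x] evaluates the
    latter up to [o(s)]. *)
Lemma second_difference (V : normedModType R) (f : V -> R) x v w (e : R) :
  (\forall y \near x, differentiable f y) -> differentiable ('D_v f) x -> 0 < e ->
  exists2 r : R, 0 < r & forall s : R, 0 < s < r ->
    `|f (s *: v + (s *: w + x)) - f (s *: v + x) - f (s *: w + x) + f x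
      - s ^+ 2 * 'D_w ('D_v f) x| <= e * s ^+ 2.
Proof.
(* For [0 <= c <= s], the lengths of [c *: v] and [c *: v + s *: w] add up to at most [s * M]; the
   summand 1 keeps [M] positive. *)
move=> df dA e0; pose A := 'D_v f; pose M := 2 * `|v| + `|w| + 1.
have M0 : 0 < M by rewrite /M ltr_wpDl// addr_ge0// mulr_ge0.
have eM : 0 < e / M by rewrite divr_gt0.
have /diff_locally/eqaddoP/(_ _ eM) near0 := dA.
have {}df : \forall k \near (0 : V), differentiable f (k + x).
  by move: df; rewrite (near_shift 0 x); apply: filterS => z /=; rewrite subr0.
have /nbhs_ballP[r /= r0 rP] : \forall k \near (0 : V), differentiable f (k + x) /\
    `|A (k + x) - A x - 'd A x k| <= e / M * `|k|.
  near=> k; split; first by near: k.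
  rewrite -addrA -opprD.
  by near: k; exact: near0.
have inr k : `|k| < r -> differentiable f (k + x) /\
    `|A (k + x) - A x - 'd A x k| <= e / M * `|k|.
  by move=> kr; apply: rP; rewrite -ball_normE /= sub0r normrN.
exists (r / M); first by rewrite divr_gt0.
move=> s /andP[s0]; rewrite ltr_pdivlMr// => sM.
have small c : 0 <= c <= s -> `|c *: v| <= s * `|v| /\ `|c *: v| < r /\
    `|c *: v + s *: w| <= s * (`|v| + `|w|) /\ `|c *: v + s *: w| < r.
  move=> /andP[c0 cs]; have cv : `|c *: v| <= s * `|v|.
    by rewrite normrZ ger0_norm// ler_wpM2r.
  have cvw : `|c *: v + s *: w| <= s * (`|v| + `|w|).
    by rewrite (le_trans (ler_normD _ _))// mulrDr lerD// normrZ gtr0_norm.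
  have v0 := normr_ge0 v; have w0 := normr_ge0 w; rewrite /M in sM.
  split => //; split; first by apply: le_lt_trans cv _; apply: le_lt_trans sM; rewrite ler_pM2l//; lra.
  by split => //; apply: le_lt_trans cvw _; apply: le_lt_trans sM; rewrite ler_pM2l//; lra.
pose phi t := f (t *: v + (s *: w + x)) - f (t *: v + x).
pose dphi t := A (t *: v + (s *: w + x)) - A (t *: v + x).
have phiD t : 0 <= t <= s -> is_derive t (1 : R) phi (dphi t).
  move=> /small[_ [h1 [_ h2]]].
  apply: is_deriveB; apply: is_derive_line.
    by rewrite addrA; case: (inr _ h2).
  by case: (inr _ h1).
have [c cs E] : exists2 c, c \in `]0, s[%R & phi s - phi 0 = dphi c * (s - 0).
  apply: MVT => //.
    by move=> t; rewrite in_itv /= => /andP[h1 h2]; apply: phiD; rewrite !ltW.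
  apply: derivable_within_continuous => t; rewrite in_itv /= => /phiD h.
  exact: ex_derive.
have {cs} /small[c1 [c2 [c3 c4]]] : 0 <= c <= s.
  by move: cs; rewrite in_itv /= => /andP[h1 h2]; rewrite !ltW.
have [_ B1] := inr _ c2; have [_ B2] := inr _ c4.
rewrite -(addrA (c *: v)) in B2.
move: E; rewrite /phi !scale0r !add0r subr0 => E.
have -> : f (s *: v + (s *: w + x)) - f (s *: v + x) - f (s *: w + x) + f x
      - s ^+ 2 * 'D_w A x = s * (dphi c - s * 'D_w A x).
  by rewrite [s * _]mulrBr [s * dphi c]mulrC -E; ring.
rewrite normrM gtr0_norm// expr2 mulrCA ler_pM2l//.
(* The linear parts differ exactly by [s * 'D_w A x], so what remains is the difference of two
   first-order remainders of [A]. *)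
have -> : dphi c - s * 'D_w A x = (A (c *: v + (s *: w + x)) - A x - 'd A x (c *: v + s *: w))
   - (A (c *: v + x) - A x - 'd A x (c *: v)).
  rewrite /dphi deriveE// linearD.
  have -> : 'd A x (s *: w) = s * 'd A x w by rewrite linearZ.
  ring.
apply: le_trans (ler_normB _ _) _.
apply: le_trans (lerD B2 B1) _.
rewrite -mulrDr -mulrA ler_pM2l// ler_pdivrMl// mulrC.
have := lerD c3 c1; rewrite -mulrDr => /le_trans; apply.
by rewrite ler_pM2l// /M; lra.
Unshelve. all: by end_near. Qed.

(** The second difference is symmetric in [v] and [w], and after division by [s ^+ 2] it is within
    [e / 2] of each mixed derivative. *)
Lemma derive_sym (V : normedModType R) (f : V -> R) x v w :
  C2_at f x -> 'D_v ('D_w f) x = 'D_w ('D_v f) x.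
Proof.
move=> [df d2f]; apply/eqP; rewrite -subr_eq0 -normr_le0.
apply/ler_addgt0Pl => e e0; rewrite addr0.
have e2 : 0 < e / 2 by rewrite divr_gt0.
have [r1 r10 P1] := second_difference w df (d2f v) e2.
have [r2 r20 P2] := second_difference v df (d2f w) e2.
pose s := Num.min r1 r2 / 2.
have m0 : 0 < Num.min r1 r2 by rewrite lt_min r10.
have s0 : 0 < s by rewrite divr_gt0.
have sm : s < Num.min r1 r2 by rewrite /s ltr_pdivrMr// ltr_pMr// ltr1n.
move: sm; rewrite lt_min => /andP[s1 s2].
have alg (p q q' x0 a b S : R) : 0 < S -> `|p - q - q' + x0 - S * a| <= e / 2 * S ->
    `|p - q' - q + x0 - S * b| <= e / 2 * S -> `|b - a| <= e.
  move=> S0; rewrite ler_norml => /andP[h1 h2]; rewrite ler_norml => /andP[h3 h4].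
  by rewrite ler_norml -(ler_pM2l S0 (- e)) -(ler_pM2l S0 _ e); apply/andP; split; lra.
apply: (alg _ _ _ _ _ _ _ _ (P1 s _)); last 1 first.
- by rewrite (addrCA (s *: v)); apply: P2; rewrite s0.
- by rewrite exprn_gt0.
- by rewrite s0.
Qed.

End Derivatives.

(** * Conditions at a maximum, second-order chain rule, orthonormal frames *)

Section Extrema.
Variable R : realType.

(** Restrict [u] to the line through [y] along [w]. If the second derivative at 0 were positive, the
    first one would be positive just after 0, and the mean value theorem would give a value above
    the maximum. *)
Lemma derive2_at_max (V : normedModType R) (u : V -> R) y w :
  (\forall z \near y, differentiable u z) -> derivable ('D_w u) y w ->
  (\forall z \near y, u z <= u y) ->
  'D_w u y = 0 /\ 'D_w ('D_w u) y <= 0.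
Proof.
move=> du d2u umax; pose g t := u (t *: w + y).
have : \forall z \near y, differentiable u z /\ u z <= u y by exact: filterI.
have dl : differentiable (fun t : R => t *: w + y) 0 by exact: ex_diff.
have cl : (fun t : R => t *: w + y) @ (0 : R) --> y.
  rewrite -[X in _ --> X]add0r -[X in _ --> X + _](scale0r w).
  exact: (differentiable_continuous dl).
move=> /cl.
move=> /nbhs_ballP[r /= r0 rP].
have inr t : `|t| < r -> differentiable u (t *: w + y) /\ g t <= g 0.
  move=> tr; rewrite /g scale0r add0r.
  by apply: (rP t); rewrite -ball_normE /= sub0r normrN.
have gD t : `|t| < r -> is_derive t (1 : R) g ('D_w u (t *: w + y)).
  by move=> /inr[h _]; exact: is_derive_line.
have in0 t : t \in `]- r, r[%R -> `|t| < r by rewrite in_itv /= ltr_norml.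
have D0 : 'D_w u y = 0.
  have g0 : is_derive (0 : R) (1 : R) g 0.
    apply: (@derive1_at_max _ _ (- r) r) => //.
    - by rewrite ge0_cp ?ltW.
    - by move=> t /in0 /gD h; exact: ex_derive.
    - by rewrite in_itv /= r0 oppr_lt0 r0.
    - by move=> t /in0 /inr[].
  have [_] : is_derive (0 : R) (1 : R) g ('D_w u ((0 : R) *: w + y)).
    by apply: gD; rewrite normr0.
  by case: g0 => [_ ->]; rewrite scale0r add0r.
split => //; rewrite leNgt; apply/negP => L0.
have : (fun h => h^-1 *: ('D_w u (h *: w + y) - 'D_w u y)) @ 0^' --> 'D_w ('D_w u) y.
  exact: d2u.
move=> /cvgr_gt /(_ _ L0) /nbhs_ballP[r' /= r'0 r'P].
have [s s0 [sr sr']] : exists2 s : R, 0 < s & s < r /\ s < r'.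
  exists (Num.min r r' / 2); first by rewrite divr_gt0// lt_min r0.
  have m0 : 0 < Num.min r r' by rewrite lt_min r0.
  have : Num.min r r' / 2 < Num.min r r' by rewrite ltr_pdivrMr// ltr_pMr// ltr1n.
  by rewrite lt_min => /andP[].
have [t ts E] : exists2 t, t \in `]0, s[%R & g s - g 0 = 'D_w u (t *: w + y) * (s - 0).
  apply: MVT => //.
    move=> t; rewrite in_itv /= => /andP[h1 h2]; apply: gD.
    by rewrite gtr0_norm// (lt_trans h2).
  apply: derivable_within_continuous => t; rewrite in_itv /= => /andP[h1 h2].
  suff : is_derive t 1 g ('D_w u (t *: w + y)) by move=> h; exact: ex_derive.
  by apply: gD; rewrite ger0_norm// (le_lt_trans h2).
move: ts; rewrite in_itv /= => /andP[t0 ts].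
have /= := r'P t; rewrite -ball_normE /= sub0r normrN gtr0_norm//.
move=> /(_ (lt_trans ts sr')); rewrite D0 subr0 gt_eqF// => /(_ isT).
rewrite [_ *: _]mulrC pmulr_lgt0 ?invr_gt0// => Dt.
have /inr[_] : `|s| < r by rewrite gtr0_norm.
by apply/negP; rewrite -ltNge -subr_gt0 E subr0 mulr_gt0.
Qed.

Lemma is_derive_sum_mul (V : normedModType R) n (a b : 'I_n -> V -> R) y w da db :
  (forall i, is_derive y w (a i) (da i)) -> (forall i, is_derive y w (b i) (db i)) ->
  is_derive y w (fun z => \sum_i a i z * b i z) (\sum_i (da i * b i y + a i y * db i)).
Proof.
move=> ha hb.
have -> : (fun z => \sum_i a i z * b i z) = \sum_i (a i * b i).
  by apply/funext => z; rewrite fct_sumE.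
have hab i : is_derive y w (a i * b i) (a i y *: db i + b i y *: da i) by exact: is_deriveM.
apply: is_derive_eq (is_derive_sum hab) _.
by apply: eq_bigr => i _; rewrite /GRing.scale /= addrC [X in X + _]mulrC.
Qed.

Lemma is_derive2_comp m n (f : 'rV[R]_m -> 'rV[R]_n) (g : 'rV[R]_n -> R) y w :
  C2_at f y -> C2_at g (f y) ->
  let v := 'D_w f y in
  is_derive y w ('D_w (g \o f))
    ('D_v ('D_v g) (f y) + 'D_('D_w ('D_w f) y) g (f y)).
Proof.
move=> [df d2f] [dg d2g] v.
have dfy := nbhs_singleton df; have dgy := nbhs_singleton dg.
have cf : {for y, continuous f} by exact: differentiable_continuous.
(* The direction ['D_w f z] moves with [z]; expanding in the fixed partial derivatives of [g] makes
   the product rule applicable. *)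
have Dc : \forall z \near y,
    \sum_i 'D_w f z 0 i * partial i g (f z) = 'D_w (g \o f) z.
  near=> z; have dfz : differentiable f z by near: z.
  have dgz : differentiable g (f z) by near: z; exact: (cf _ dg).
  by have [_ ->] := is_derive_comp w dfz dgz; rewrite (derive_sum_partial _ dgz).
apply: near_eq_is_derive Dc _.
apply: is_derive_eq; first apply: is_derive_sum_mul => i.
- by apply: is_derive_coord; exact: diff_derivable.
- by apply: is_derive_comp => //; exact: d2g.
rewrite /= big_split /= addrC; congr (_ + _).
  have Dg : \forall z \near f y, \sum_i v 0 i * partial i g z = 'D_v g z.
    by apply: filterS dg => z dgz; rewrite derive_sum_partial.
  have : is_derive (f y) v (fun z => \sum_i v 0 i * partial i g z)
      (\sum_i (0 * partial i g (f y) + v 0 i * 'D_v (partial i g) (f y))).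
    apply: (@is_derive_sum_mul _ _ (fun i _ => v 0 i) (fun i => partial i g) _ _ (fun=> 0)) => i.
    by apply/derivableP/diff_derivable/d2g.
  move=> /(near_eq_is_derive Dg) [_ ->].
  by apply: eq_bigr => i _; rewrite mul0r add0r.
by rewrite (derive_sum_partial _ dgy).
Unshelve. all: by end_near. Qed.

(** Induction on the size by block elimination: clearing the first row and column leaves the Schur
    complement [S], which is again symmetric and positive definite. The rows of [E] are an
    orthonormal frame for [A]. *)
Lemma posdef_orthonormal_frame n (A : 'M[R]_n) :
  A^T = A -> (forall v : 'rV[R]_n, v != 0 -> 0 < (v *m A *m v^T) 0 0) ->
  exists E : 'M[R]_n, E *m A *m E^T = 1%:M.
Proof.
elim: n A => [|n IH] A symA posA; first by exists 0; apply/matrixP => -[].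
pose a := A 0 0; pose A' : 'M[R]_(1 + n) := A.
pose c : 'cV[R]_n := dlsubmx A'; pose D : 'M[R]_n := drsubmx A'.
pose B : 'M[R]_(1 + n) := block_mx a%:M c^T c D.
have symA' : A'^T = A' by [].
have AE : A = B.
  have ulE : a%:M = ulsubmx A'.
    apply/rowP => i; rewrite !ord1 !mxE eqxx mulr1n.
    by congr (A _ _); apply: val_inj.
  have urE : c^T = ursubmx A' by rewrite /c trmx_dlsub symA'.
  by rewrite /B ulE urE -/A' submxK.
have a0 : 0 < a.
  have := posA (delta_mx 0 0); rewrite -rowE trmx_delta -colE !mxE; apply.
  by apply/eqP => /matrixP/(_ 0 0); rewrite !mxE eqxx => /eqP; rewrite oner_eq0.
have an0 := lt0r_neq0 a0.
pose T : 'M[R]_(1 + n) := block_mx 1%:M 0 (- a^-1 *: c) 1%:M.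
pose S := D - a^-1 *: (c *m c^T).
have TBT : T *m B *m T^T = block_mx a%:M 0 0 S.
  rewrite /T /B tr_block_mx !mulmx_block !(mul1mx, mulmx1, mul0mx, mulmx0, trmx1, trmx0, addr0).
  rewrite mul_mx_scalar scalerA mulrN mulfV// scaleN1r addNr mul0mx add0r.
  rewrite linearZ /= mul_scalar_mx scalerA mulrN mulfV// scaleN1r addNr.
  by rewrite -scalemxAl scaleNr addrC.
have Tu : T \in unitmx by rewrite unitmxE det_lblock !det1 mulr1 unitr1.
have [||E' E'S] := IH S.
- by rewrite /S linearB /= linearZ /= trmx_mul trmxK /D trmx_drsub symA'.
(* The value of [S] on [v] is that of [A] on the nonzero vector [w]. *)
- move=> v v0; pose w : 'rV[R]_(1 + n) := row_mx 0 v *m T.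
  have w0 : w != 0.
    apply: contraNneq v0 => w0; have : row_mx (0 : 'rV[R]_1) v = 0.
      by rewrite -[LHS](mulmxK Tu) -/w w0 mul0mx.
    by move=> /eqP; rewrite row_mx_eq0 => /andP[].
  have := posA w w0; rewrite AE /w trmx_mul !mulmxA -(mulmxA _ T B) -(mulmxA _ (T *m B)) TBT.
  by rewrite mul_row_block !mul0mx !mulmx0 !add0r tr_row_mx mul_row_col mul0mx add0r.
pose F : 'M[R]_(1 + n) := block_mx ((Num.sqrt a)^-1)%:M 0 0 E'.
suff FBF : F *m (T *m B *m T^T) *m F^T = 1%:M.
  by exists (F *m T); rewrite AE trmx_mul !mulmxA in FBF *.
rewrite TBT /F tr_block_mx !mulmx_block.
rewrite !(mul0mx, mulmx0, addr0, add0r, trmx0) E'S.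
rewrite tr_scalar_mx -!scalar_mxM -[in X in _ * X * _](sqr_sqrtr (ltW a0)) expr2.
by rewrite mulKf ?mulfV ?gt_eqF ?sqrtr_gt0// -scalar_mx_block.
Qed.

End Extrema.

(** * Christoffel symbols and the Hessian of |x|^2 in Gibbons-Hawking coordinates *)

Section Hessian.
Variable R : realType.

Lemma mulmx_form_sum m n (v : 'rV[R]_m) (A : 'M[R]_(m, n)) (w : 'rV[R]_n) :
  (v *m A *m w^T) 0 0 = \sum_i v 0 i * \sum_j A i j * w 0 j.
Proof.
rewrite -mulmxA mxE; apply: eq_bigr => i _; rewrite mxE; congr (_ * _).
by apply: eq_bigr => j _; rewrite mxE.
Qed.

Lemma is_derive_mulmx_form (V : normedModType R) m n (G : V -> 'M[R]_(m, n)) z u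
    (v : 'rV[R]_m) (w : 'rV[R]_n) :
  derivable G z u ->
  is_derive z u (fun y => (v *m G y *m w^T) 0 0) ((v *m 'D_u G z *m w^T) 0 0).
Proof.
move=> dG; under eq_fun do rewrite mulmx_form_sum.
apply: is_derive_eq.
  apply: (@is_derive_sum_mul _ _ m (fun i _ => v 0 i)
    (fun i y => \sum_j G y i j * w 0 j) _ _ (fun=> 0)) => i.
  apply: (@is_derive_sum_mul _ _ n (fun j y => G y i j) (fun j _ => w 0 j) _ _ _ (fun=> 0)) => j.
  exact: is_derive_coord.
rewrite mulmx_form_sum; apply: eq_bigr => i _; rewrite mul0r add0r; congr (_ * _).
by apply: eq_bigr => j _; rewrite mulr0 addr0.
Qed.

(** [Y] is the gradient of [h] for [G]. Pairing the Christoffel vectors with [dh] therefore lowers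
    their index against [Y], and the three terms of the Koszul formula become three directional
    derivatives of [G]. *)
Lemma christoffel_contract n (G : 'rV[R]_n -> 'M[R]_n) (h : 'rV[R]_n -> R) z (v : 'rV[R]_n) :
  differentiable G z -> differentiable h z ->
  let Y := (\row_a partial a h z) *m invmx (G z) in
  'D_(\sum_k \sum_l (v 0 k * v 0 l) *: christoffel G z k l) h z =
  2^-1 * ((Y *m 'D_v G z *m v^T) 0 0 + (v *m 'D_v G z *m Y^T) 0 0 - (v *m 'D_Y G z *m v^T) 0 0).
Proof.
move=> dG dh Y; set Gi := invmx (G z) in Y *.
(* [T] is twice the Christoffel symbol of the first kind, and [t] is its contraction with [v] in
   both lower slots. *)
pose T k l b := partial k G z b l + partial l G z k b - partial b G z k l.
pose t b := \sum_k \sum_l v 0 k * v 0 l * T k l b.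
have -> : 'D_(\sum_k \sum_l (v 0 k * v 0 l) *: christoffel G z k l) h z =
    \sum_b Y 0 b * (2^-1 * t b).
  rewrite (derive_sum_partial _ dh).
  transitivity (\sum_a \sum_b partial a h z * (Gi a b * (2^-1 * t b))).
    apply: eq_bigr => a _; rewrite -[LHS]/(_ * _) mulrC -mulr_sumr; congr (_ * _).
    rewrite summxE; transitivity (\sum_k \sum_l \sum_b Gi a b * (2^-1 * (v 0 k * v 0 l * T k l b))).
      apply: eq_bigr => k _; rewrite summxE; apply: eq_bigr => l _.
      rewrite !mxE mulr_sumr; apply: eq_bigr => b _; rewrite /T; ring.
    under eq_bigr do rewrite exchange_big /=.
    rewrite exchange_big /=; apply: eq_bigr => b _.
    by rewrite /t !mulr_sumr; apply: eq_bigr => k _; rewrite !mulr_sumr.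
  rewrite exchange_big /=; apply: eq_bigr => b _.
  by rewrite !mxE mulr_suml; apply: eq_bigr => a _; rewrite mxE mulrA.
have tE b : t b = ('D_v G z *m v^T) b 0 + (v *m 'D_v G z) 0 b - (v *m partial b G z *m v^T) 0 0.
  have e1 : \sum_k \sum_l v 0 k * v 0 l * partial k G z b l = ('D_v G z *m v^T) b 0.
    rewrite mxE exchange_big; apply: eq_bigr => l _ /=.
    rewrite (derive_sum_partial _ dG) summxE mulr_suml; apply: eq_bigr => k _.
    by rewrite !mxE; ring.
  have e2 : \sum_k \sum_l v 0 k * v 0 l * partial l G z k b = (v *m 'D_v G z) 0 b.
    rewrite mxE; apply: eq_bigr => k _.
    rewrite (derive_sum_partial _ dG) summxE mulr_sumr; apply: eq_bigr => l _.
    by rewrite !mxE; ring.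
  have e3 : \sum_k \sum_l v 0 k * v 0 l * partial b G z k l = (v *m partial b G z *m v^T) 0 0.
    rewrite mulmx_form_sum; apply: eq_bigr => k _; rewrite mulr_sumr.
    by apply: eq_bigr => l _; ring.
  rewrite -e1 -e2 -e3 -big_split -sumrB /=; apply: eq_bigr => k _.
  rewrite -big_split -sumrB /=; apply: eq_bigr => l _; rewrite /T; ring.
have -> : (v *m 'D_Y G z *m v^T) 0 0 = \sum_b Y 0 b * (v *m partial b G z *m v^T) 0 0.
  rewrite (derive_sum_partial _ dG) mulmx_sumr mulmx_suml summxE.
  by apply: eq_bigr => b _; rewrite -scalemxAr -scalemxAl mxE.
have -> : (Y *m 'D_v G z *m v^T) 0 0 = \sum_b Y 0 b * ('D_v G z *m v^T) b 0.
  by rewrite -mulmxA mxE.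
have -> : (v *m 'D_v G z *m Y^T) 0 0 = \sum_b Y 0 b * (v *m 'D_v G z) 0 b.
  by rewrite mxE; apply: eq_bigr => b _; rewrite [Y^T _ _]mxE mulrC.
rewrite -big_split -sumrB /= mulr_sumr; apply: eq_bigr => b _.
by rewrite tE; ring.
Qed.

End Hessian.

(** * Symmetry and closure properties of [C2_at] *)

Section C2Algebra.
Variables (R : realType) (V : normedModType R).

Lemma derive_sym_mx m n (f : V -> 'M[R]_(m, n)) x v w :
  C2_at f x -> 'D_v ('D_w f) x = 'D_w ('D_v f) x.
Proof.
move=> Cf; have [df d2f] := Cf; apply/matrixP => i j.
have coordE u u' : 'D_u ('D_u' f) x i j = 'D_u ('D_u' (fun y => f y i j)) x.
  have [_ <-] := is_derive_coord i j (diff_derivable (v := u) (d2f u')).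
  apply: near_eq_derive; apply: filterS df => y dfy.
  by have [_ ->] := is_derive_coord i j (diff_derivable (v := u') dfy).
apply: etrans (coordE v w) _; apply: etrans (esym (coordE w v)).
exact: (derive_sym v w (C2_at_coord i j Cf)).
Qed.

Lemma C2_at_cst (W : normedModType R) (c : W) x : C2_at (cst c : V -> W) x.
Proof.
split; first exact: nearW.
by move=> v; rewrite (_ : 'D_v _ = cst 0)//; apply/funext => y; rewrite derive_cst.
Qed.

Lemma C2_atD (W : normedModType R) (f g : V -> W) x :
  C2_at f x -> C2_at g x -> C2_at (f + g) x.
Proof.
move=> [df d2f] [dg d2g]; split.
  by apply: filterS2 df dg => y; exact: differentiableD.
move=> v; have E : \forall y \near x, ('D_v f + 'D_v g) y = 'D_v (f + g) y.
  by apply: filterS2 df dg => y dfy dgy; rewrite deriveD//; exact: diff_derivable.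
by apply: near_eq_differentiable E _; exact: differentiableD.
Qed.

Lemma C2_atM (f g : V -> R) x : C2_at f x -> C2_at g x -> C2_at (f * g) x.
Proof.
move=> [df d2f] [dg d2g]; split.
  by apply: filterS2 df dg => y; exact: differentiableM.
have dfx := nbhs_singleton df; have dgx := nbhs_singleton dg.
move=> v.
have E : \forall y \near x, (f * 'D_v g + g * 'D_v f) y = 'D_v (f * g) y.
  by apply: filterS2 df dg => y dfy dgy; rewrite deriveM//; exact: diff_derivable.
by apply: near_eq_differentiable E _; apply: differentiableD; exact: differentiableM.
Qed.

Lemma C2_at_sum (W : normedModType R) n (f : 'I_n -> V -> W) x :
  (forall i, C2_at (f i) x) -> C2_at (\sum_i f i) x.
Proof.
move=> Cf; apply: (big_ind (fun g => C2_at g x)) => [|g h|i _]; last exact: Cf.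
  exact: C2_at_cst.
exact: C2_atD.
Qed.

End C2Algebra.

(** The scalar computation behind the Hessian formula. Here [Y] stands for the projected gradient,
    [S], [T], [T'] for second derivatives of the projection, and [a1], [a2], [a3] for derivatives of
    the connection form. [S] cancels against [H2] by the value of [Y], [T] against [T'] by symmetry,
    and [a2] is multiplied by [eY = 0]; only [a1 - a3], a value of the curvature, survives. *)
Lemma gh_hessian_algebra (R : realType) (psi ev eY a1 a2 a3 p q star H2 D A B C : R)
    (W x g Y S T T' : 'I_3 -> R) : psi != 0 ->
  H2 = 2 * \sum_a (W a ^+ 2 + x a * S a) -> D = 2^-1 * (A + B - C) ->
  A = p * (\sum_a Y a * W a - psi^-1 ^+ 2 * (eY * ev)) +
      psi^-1 * (a1 * ev + eY * a2) + psi * \sum_a (T a * W a + Y a * S a) ->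
  B = p * (\sum_a W a * Y a - psi^-1 ^+ 2 * (ev * eY)) +
      psi^-1 * (a2 * eY + ev * a1) + psi * \sum_a (S a * Y a + W a * T a) ->
  C = q * (\sum_a W a * W a - psi^-1 ^+ 2 * (ev * ev)) +
      psi^-1 * (a3 * ev + ev * a3) + psi * \sum_a (T' a * W a + W a * T' a) ->
  eY = 0 -> (forall a, Y a = 2 * psi^-1 * x a) -> (forall a, T' a = T a) ->
  p = \sum_a g a * W a -> q = 2 * psi^-1 * \sum_a g a * x a ->
  a1 - a3 = 2 * psi^-1 * star ->
  psi * (H2 - D) =
  2 * psi * (\sum_a W a ^+ 2) - 2 * (psi^-1 * ev) * star
  - 2 * (\sum_a g a * W a) * (\sum_a x a * W a)
  - (\sum_a g a * x a) * (psi^-1 * ev) ^+ 2 + (\sum_a g a * x a) * \sum_a W a ^+ 2.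
Proof.
move=> psi0 -> -> -> -> -> -> YE TE -> -> K.
have -> : a1 = a3 + 2 * psi^-1 * star by rewrite -K; ring.
rewrite !big_ord_recl !big_ord0 !YE !TE; field.
exact: psi0.
Qed.

(** * The Gibbons-Hawking metric read in one chart *)

Section GibbonsHawking.
Variables (R : realType) (P : 'rV[R]_4 -> 'rV[R]_3) (phi : 'rV[R]_3 -> R).
Variables (e : 'rV[R]_4 -> 'cV[R]_4) (G : 'rV[R]_4 -> 'M[R]_4) (z : 'rV[R]_4).
Hypothesis C2P : C2_at P z.
Hypothesis de : differentiable e z.
Hypothesis dG : differentiable G z.
Hypothesis dphi : differentiable phi (P z).
Hypothesis phi_gt0 : 0 < phi (P z).
Hypothesis GE : \forall y \near z,
  G y = (phi (P y))^-1 *: (e y *m (e y)^T) + phi (P y) *: (jacobian P y *m (jacobian P y)^T).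
Hypothesis monopole : dform e z =
  jacobian P z *m hodge_star3 (fun a => partial a phi (P z)) *m (jacobian P z)^T.
Hypothesis Gunit : G z \in unitmx.

Let dP : differentiable P z. Proof. by case: C2P => /nbhs_singleton. Qed.
Let phi_neq0 : phi (P z) != 0. Proof. exact: lt0r_neq0. Qed.

Let E (v y : 'rV[R]_4) : R := (v *m e y) 0 0.

(** The metric formula contracted with two fixed vectors; since it holds near [z], it can be
    differentiated there. *)
Lemma gh_form_near (v w : 'rV[R]_4) : \forall y \near z, (v *m G y *m w^T) 0 0 =
  (phi (P y))^-1 * (E v y * E w y) +
  phi (P y) * \sum_a 'D_v P y 0 a * 'D_w P y 0 a.
Proof.
case: C2P => dPn _; apply: filterS2 GE dPn => y -> dPy.
rewrite mulmxDr mulmxDl -!(scalemxAl, scalemxAr) mxE; congr (_ + _); rewrite mxE; congr (_ * _).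
  by rewrite mulmxA -(mulmxA (v *m e y)) -trmx_mul mxE big_ord1; congr (_ * _); rewrite mxE.
rewrite mulmxA -(mulmxA (v *m jacobian P y)) -trmx_mul !deriveEjacobian// mxE.
by apply: eq_bigr => a _; congr (_ * _); rewrite mxE.
Qed.

Lemma is_derive_connection u v : is_derive z u (E v) ((v *m 'D_u e z) 0 0).
Proof.
have := @is_derive_mulmx_form R _ _ _ e z u v 1 (diff_derivable de).
by rewrite trmx1 mulmx1; under eq_fun do rewrite mulmx1.
Qed.

(** Fixed [v] and [w] are commuting vector fields, so the exterior derivative is the difference of
    the derivatives of [E w] along [v] and of [E v] along [w]. *)
Lemma dform_connection v w :
  (w *m 'D_v e z) 0 0 - (v *m 'D_w e z) 0 0 = (v *m dform e z *m w^T) 0 0.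
Proof.
have expand (u u' : 'rV[R]_4) : (u *m 'D_u' e z) 0 0 = \sum_i \sum_j u' 0 i * partial i e z j 0 * u 0 j.
  rewrite (derive_sum_partial _ de) mulmx_sumr summxE; apply: eq_bigr => i _.
  rewrite -scalemxAr 2!mxE mulr_sumr; apply: eq_bigr => j _; ring.
have expand' : (v *m 'D_w e z) 0 0 = \sum_i \sum_j w 0 j * partial j e z i 0 * v 0 i.
  by rewrite expand exchange_big.
apply: etrans (congr2 (fun a b => a - b) (expand w v) expand') _.
rewrite -sumrB mulmx_form_sum; apply: eq_bigr => i _.
rewrite -sumrB mulr_sumr; apply: eq_bigr => j _; rewrite [dform _ _ _ _]mxE; ring.
Qed.

Lemma derive_gh_form u v w : let psi := phi (P z) in
  (v *m 'D_u G z *m w^T) 0 0 =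
  'D_('D_u P z) phi (P z) *
    (\sum_a 'D_v P z 0 a * 'D_w P z 0 a - psi^-1 ^+ 2 * (E v z * E w z)) +
  psi^-1 * ((v *m 'D_u e z) 0 0 * E w z + E v z * (w *m 'D_u e z) 0 0) +
  psi * \sum_a ('D_u ('D_v P) z 0 a * 'D_w P z 0 a + 'D_v P z 0 a * 'D_u ('D_w P) z 0 a).
Proof.
move=> psi; have [_ <-] := is_derive_mulmx_form v w (diff_derivable (v := u) dG).
rewrite (near_eq_derive _ (gh_form_near v w)).
have hpsi := is_derive_comp u dP dphi.
have hV : is_derive z u (fun y => (phi (P y))^-1) (- psi^-1 ^+ 2 * 'D_('D_u P z) phi (P z)).
  have dc : derivable (phi \o P) z u by case: hpsi.
  apply: DeriveDef; first exact: (derivableV phi_neq0 dc).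
  have [_ <-] := hpsi; apply: etrans (deriveV phi_neq0 dc) _.
  by rewrite /psi exprVn.
have hS : is_derive z u (fun y => \sum_a 'D_v P y 0 a * 'D_w P y 0 a)
    (\sum_a ('D_u ('D_v P) z 0 a * 'D_w P z 0 a + 'D_v P z 0 a * 'D_u ('D_w P) z 0 a)).
  by apply: is_derive_sum_mul => a; apply: is_derive_coord; apply: diff_derivable; apply: C2P.2.
have hE := is_deriveM (is_derive_connection u v) (is_derive_connection u w).
have [_ ->] := is_deriveD (is_deriveM hV hE) (is_deriveM hpsi hS).
rewrite /GRing.scale /= /psi.
rewrite -[(E v * E w) z]/(E v z * E w z); ring.
Qed.

Definition sqnorm_at (y : 'rV[R]_4) : R := \sum_a P y 0 a ^+ 2.

Lemma sqnorm_atE : sqnorm_at = \sum_a (fun y => P y 0 a) * (fun y => P y 0 a).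
Proof. by apply/funext => y; rewrite fct_sumE; apply: eq_bigr => a _; rewrite expr2. Qed.

Lemma C2_sqnorm_at : C2_at sqnorm_at z.
Proof. by rewrite sqnorm_atE; apply: C2_at_sum => a; apply: C2_atM; exact: C2_at_coord. Qed.

Lemma is_derive_sqnorm_at y v : differentiable P y ->
  is_derive y v sqnorm_at (2 * \sum_a P y 0 a * 'D_v P y 0 a).
Proof.
move=> dPy; have h a := is_derive_coord 0 a (diff_derivable (v := v) dPy).
apply: is_derive_eq; first by rewrite /sqnorm_at; under eq_fun do under eq_bigr do rewrite expr2;
  exact: (is_derive_sum_mul h h).
by rewrite mulr_sumr; apply: eq_bigr => a _; ring.
Qed.

Lemma derive2_sqnorm_at v :
  'D_v ('D_v sqnorm_at) z = 2 * \sum_a ('D_v P z 0 a ^+ 2 + P z 0 a * 'D_v ('D_v P) z 0 a).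
Proof.
have Dn : \forall y \near z, 'D_v sqnorm_at y = 2 * \sum_a P y 0 a * 'D_v P y 0 a.
  by apply: filterS C2P.1 => y dPy; have [] := is_derive_sqnorm_at v dPy.
rewrite (near_eq_derive _ Dn).
have h a := is_derive_coord 0 a (diff_derivable (v := v) dP).
have h2 a := is_derive_coord 0 a (diff_derivable (v := v) (C2P.2 v)).
have [_ ->] := is_deriveZ 2 (is_derive_sum_mul h h2).
by rewrite /GRing.scale /=; congr (_ * _); apply: eq_bigr => a _; ring.
Qed.

Let grad := (\row_a partial a sqnorm_at z) *m invmx (G z).

(** The squared norm factors through [P], so its gradient is horizontal and projects to [phi^-1]
    times the Euclidean gradient of the squared norm. Both facts are read off by comparing
    coefficients on the columns of [e z] and [J]. *)
Lemma gh_gradient : E grad z = 0 /\ forall a, 'D_grad P z 0 a = 2 * (phi (P z))^-1 * P z 0 a.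
Proof.
set J := jacobian P z; set psi := phi (P z).
have Gz : G z = psi^-1 *: (e z *m (e z)^T) + psi *: (J *m J^T) by exact: nbhs_singleton GE.
(* The metric formula factors [G z] through [A], so invertibility of [G z] makes the form and the
   three differentials of [P] linearly independent. *)
pose A : 'M[R]_4 := row_mx (e z) J.
have Au : A \in unitmx.
  have : A *m (col_mx (psi^-1 *: (e z)^T) (psi *: J^T) *m invmx (G z)) = 1%:M.
    by rewrite mulmxA (@mul_row_col _ 4 1 3 4) -!scalemxAr -Gz mulmxV.
  by case/mulmx1_unit.
have dh : \row_a partial a sqnorm_at z = 2 *: P z *m J^T.
  apply/rowP => i; rewrite mxE; have [_ h] := is_derive_sqnorm_at (delta_mx 0 i) dP.
  apply: etrans h _.
  rewrite -scalemxAl !mxE mulr_sumr [RHS]mulr_sumr; apply: eq_bigr => a _.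
  by rewrite deriveEjacobian// -rowE !mxE.
have gG : grad *m G z = 2 *: P z *m J^T by rewrite /grad mulmxKV.
pose r : 'rV[R]_4 := row_mx (psi^-1 *: (grad *m e z)) (psi *: (grad *m J) - 2 *: P z).
have r0 : r = 0.
  rewrite -[LHS](mulmxK (_ : A^T \in unitmx)) ?unitmx_tr//.
  rewrite [r *m _](_ : _ = 0) ?mul0mx//.
  rewrite /r /A (@tr_row_mx _ 4 1 3) (@mul_row_col _ 1 1 3 4) mulmxBl -gG Gz mulmxDr.
  by rewrite -!scalemxAl -!scalemxAr !mulmxA addrA subrr.
move: r0 => /eqP; rewrite (@row_mx_eq0 _ 1 1 3) => /andP[/eqP h1 /eqP h2]; split.
  apply/eqP; move/matrixP/(_ 0 0): h1; rewrite !mxE => /eqP.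
  by rewrite mulf_eq0 invr_eq0 (negPf phi_neq0) /= /E mxE.
move=> a; rewrite deriveEjacobian// -/J.
have -> : 2 * psi^-1 * P z 0 a = psi^-1 * (2 * P z 0 a) by ring.
move: h2; set M := grad *m J => /matrixP/(_ 0 a); rewrite !mxE => /eqP.
by rewrite subr_eq0 => /eqP <-; rewrite mulKf.
Qed.

(** The Hodge star term is the triple product of [g], [W] and [x]. It arises from the exterior
    derivative of the connection form on [grad] and [v], which the monopole equation expresses
    through the gradient of the potential. *)
Lemma gh_hessian v :
  let x a := P z 0 a in let psi := phi (P z) in
  let W a := 'D_v P z 0 a in let al := psi^-1 * E v z in
  let g a := partial a phi (P z) in
  psi * ('D_v ('D_v sqnorm_at) z -
    'D_(\sum_k \sum_l (v 0 k * v 0 l) *: christoffel G z k l) sqnorm_at z) =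
  2 * psi * (\sum_a W a ^+ 2) - 2 * al * (\sum_a \sum_b W a * hodge_star3 g a b * x b)
  - 2 * (\sum_a g a * W a) * (\sum_a x a * W a)
  - (\sum_a g a * x a) * al ^+ 2 + (\sum_a g a * x a) * \sum_a W a ^+ 2.
Proof.
move=> x psi W al g; have [gE gP] := gh_gradient.
have dW : 'D_('D_v P z) phi (P z) = \sum_a g a * W a.
  by rewrite (derive_sum_partial _ dphi); apply: eq_bigr => a _; rewrite -[LHS]/(_ * _) mulrC.
have dY : 'D_('D_grad P z) phi (P z) = 2 * psi^-1 * \sum_a g a * x a.
  rewrite (derive_sum_partial _ dphi) mulr_sumr; apply: eq_bigr => a _.
  by rewrite gP -/psi -[LHS]/(_ * _) /x /g; ring.
have K : (grad *m 'D_v e z) 0 0 - (v *m 'D_grad e z) 0 0 =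
    2 * psi^-1 * \sum_a \sum_b W a * hodge_star3 g a b * x b.
  rewrite dform_connection monopole !mulmxA -deriveEjacobian// -mulmxA -trmx_mul.
  rewrite -deriveEjacobian// mulmx_form_sum mulr_sumr; apply: eq_bigr => a _.
  rewrite !mulr_sumr; apply: eq_bigr => b _; rewrite gP -/psi /W /x; ring.
have dn : differentiable sqnorm_at z by exact: (nbhs_singleton C2_sqnorm_at.1).
apply: (@gh_hessian_algebra R psi (E v z) (E grad z) _ _ _ _ _ _ _ _ _ _ _ W x g
  (fun a => 'D_grad P z 0 a) (fun a => 'D_v ('D_v P) z 0 a) (fun a => 'D_v ('D_grad P) z 0 a)
  (fun a => 'D_grad ('D_v P) z 0 a)).
- exact: phi_neq0.
- exact: derive2_sqnorm_at.
- exact: christoffel_contract.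
- exact: derive_gh_form.
- exact: derive_gh_form.
- exact: derive_gh_form.
- exact: gE.
- exact: gP.
- by move=> a; rewrite (derive_sym_mx grad v C2P).
- exact: dW.
- exact: dY.
- exact: K.
Qed.

End GibbonsHawking.

(** * The maximum principle for minimal immersions *)

Section MaximumPrinciple.
Variables (R : realType) (d n : nat).
Variables (G : 'rV[R]_n -> 'M[R]_n) (f : 'rV[R]_d -> 'rV[R]_n) (y : 'rV[R]_d).
Hypothesis C2f : C2_at f y.

Let df : differentiable f y. Proof. by case: C2f => /nbhs_singleton. Qed.

Lemma derive2_sum_partial w :
  'D_w ('D_w f) y = \sum_i \sum_j (w 0 i * w 0 j) *: partial i (partial j f) y.
Proof.
rewrite (derive_sum_partial _ (C2f.2 w)); apply: eq_bigr => i _.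
have Dn : \forall x \near y, 'D_w f x = (\sum_j w 0 j *: partial j f) x.
  apply: filterS C2f.1 => x dfx; rewrite fct_sumE.
  exact: derive_sum_partial.
have dj j : derivable (partial j f) y (delta_mx 0 i) by apply/diff_derivable/C2f.2.
rewrite {1}/partial (near_eq_derive _ Dn) derive_sum => [|j]; last exact: derivableZ.
by rewrite scaler_sumr; apply: eq_bigr => j _; rewrite deriveZ// scalerA.
Qed.

(** Both sides are the covariant acceleration at [y] of the image under [f] of the straight line of
    direction [w]. *)
Lemma cov_derive_contract w : let v := 'D_w f y in
  \sum_i \sum_j (w 0 i * w 0 j) *: cov_derive G f y i j =
  'D_w ('D_w f) y + \sum_k \sum_l (v 0 k * v 0 l) *: christoffel G (f y) k l.
Proof.
move=> v; rewrite derive2_sum_partial /cov_derive.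
under eq_bigr do under eq_bigr do rewrite scalerDr.
under eq_bigr do rewrite big_split /=.
rewrite big_split /=; congr (_ + _).
have vE k : v 0 k = \sum_i w 0 i * partial i f y 0 k.
  rewrite /v (derive_sum_partial _ df) summxE.
  by apply: eq_bigr => i _; rewrite mxE.
clearbody v; apply/rowP => a; rewrite !summxE.
transitivity (\sum_i \sum_j \sum_k \sum_l
    w 0 i * partial i f y 0 k * (w 0 j * partial j f y 0 l) * christoffel G (f y) k l 0 a).
  apply: eq_bigr => i _; rewrite summxE; apply: eq_bigr => j _; rewrite mxE summxE mulr_sumr.
  apply: eq_bigr => k _; rewrite summxE mulr_sumr; apply: eq_bigr => l _; rewrite mxE; ring.
under eq_bigr do rewrite exchange_big /=.
rewrite exchange_big; apply: eq_bigr => k _ /=; rewrite summxE.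
under eq_bigr do rewrite exchange_big /=.
rewrite exchange_big; apply: eq_bigr => l _ /=.
rewrite [RHS]mxE (vE k) (vE l) 2!mulr_suml; apply: eq_bigr => i _.
by rewrite mulr_sumr mulr_suml.
Qed.

(** Suppose the Hessian were positive on all nonzero vectors. Summed over an orthonormal frame of
    the tangent space, the second derivatives of [h \o f] are nonpositive; they equal the trace of
    the Hessian plus [dh] of the mean curvature vector, which is zero. The trace would then be both
    positive and nonpositive. *)
Lemma minimal_hessian_at_max (h : 'rV[R]_n -> R) :
  C2_at h (f y) ->
  (G (f y))^T = G (f y) ->
  (forall v : 'rV[R]_n, v != 0 -> 0 < (v *m G (f y) *m v^T) 0 0) ->
  \rank (jacobian f y) = d -> (0 < d)%N ->
  mean_curvature G f y = 0 ->
  (\forall x \near y, h (f x) <= h (f y)) ->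
  exists2 v, v != 0 &
    'D_v ('D_v h) (f y) -
    'D_(\sum_k \sum_l (v 0 k * v 0 l) *: christoffel G (f y) k l) h (f y) <= 0.
Proof.
move=> C2h symG posG rk d0 H0 hmax; apply: contrapT => noV.
have Hpos v : v != 0 -> 0 < 'D_v ('D_v h) (f y) -
    'D_(\sum_k \sum_l (v 0 k * v 0 l) *: christoffel G (f y) k l) h (f y).
  by move=> v0; rewrite ltNge; apply/negP => le0; apply: noV; exists v.
have dh : differentiable h (f y) by exact: (nbhs_singleton C2h.1).
set Jf := jacobian f y in rk.
have Jfree : row_free Jf by rewrite /row_free rk.
pose gam := induced_metric G f y.
have gamE : gam = Jf *m G (f y) *m Jf^T by [].
have [| |E EgE] := @posdef_orthonormal_frame R d gam.
- by rewrite gamE !trmx_mul trmxK symG mulmxA.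
- move=> w w0; rewrite gamE !mulmxA -mulmxA -trmx_mul; apply: posG.
  by apply: contraNneq w0 => /eqP; rewrite mulmx_free_eq0.
(* This turns the trace with respect to the induced metric into a sum over the rows of the frame. *)
have gamV : invmx gam = E^T *m E.
  have h1 : E^T *m (E *m gam) = 1%:M by apply: mulmx1C; rewrite -EgE.
  have gu : gam \in unitmx by have := h1; rewrite mulmxA => /mulmx1_unit[].
  by rewrite -[LHS]mul1mx -h1 mulmxA mulmxK.
pose w k := row k E.
pose L (v : 'rV[R]_n) := 'd h (f y) v.
have Lsum (c : 'I_d -> 'I_d -> R) (X : 'I_d -> 'I_d -> 'rV[R]_n) :
    L (\sum_i \sum_j c i j *: X i j) = \sum_i \sum_j c i j * L (X i j).
  rewrite /L linear_sum; apply: eq_bigr => i _.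
  by rewrite linear_sum; apply: eq_bigr => j _; rewrite linearZ.
have LE v : 'D_v h (f y) = L v by rewrite deriveE.
have cf : {for y, continuous f} by exact: differentiable_continuous.
have du : \forall x \near y, differentiable (h \o f) x.
  near=> x; apply: differentiable_comp.
    by near: x; exact: C2f.1.
  by near: x; exact: (cf _ C2h.1).
have ext u : 'D_u (h \o f) y = 0 /\ 'D_u ('D_u (h \o f)) y <= 0.
  apply: derive2_at_max => //.
  by case: (is_derive2_comp u C2f C2h).
have crit u : L (u *m Jf) = 0.
  rewrite -LE -deriveEjacobian//.
  have [_ <-] := is_derive_comp u df dh.
  exact: (ext u).1.
(* At a critical point [dh] kills tangent vectors, so it does not distinguish the second fundamental
   form from the full covariant derivative. *)
have Ltan v : L (tangent_proj G f y v) = 0 by rewrite /tangent_proj; exact: crit.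
have LII i j : L (second_fundamental_form G f y i j) = L (cov_derive G f y i j).
  by rewrite /second_fundamental_form /L linearB /= -/(L _) -/(L _) Ltan subr0.
have sum0 : \sum_k L (\sum_i \sum_j (w k 0 i * w k 0 j) *: cov_derive G f y i j) = 0.
  have : L (mean_curvature G f y) = 0 by rewrite H0 /L linear0.
  rewrite /mean_curvature -/gam gamV Lsum => H0L; rewrite -[RHS]H0L.
  transitivity (\sum_k \sum_i \sum_j w k 0 i * w k 0 j * L (cov_derive G f y i j)).
    by apply: eq_bigr => k _; exact: Lsum.
  rewrite exchange_big; apply: eq_bigr => i _ /=; rewrite exchange_big; apply: eq_bigr => j _ /=.
  rewrite LII [(E^T *m E) _ _]mxE mulr_suml; apply: eq_bigr => k _.
  by rewrite /w !mxE.
pose v k := 'D_(w k) f y.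
have v0 k : v k != 0.
  rewrite /v deriveEjacobian// mulmx_free_eq0//; apply/eqP => wk0.
  have /matrixP/(_ k k) := EgE.
  rewrite -mulmxA mxE big1 ?mxE ?eqxx => [/eqP|i _]; first by rewrite eq_sym oner_eq0.
  by move/rowP/(_ i): wk0; rewrite !mxE => ->; rewrite mul0r.
pose H k := 'D_(v k) ('D_(v k) h) (f y) -
    'D_(\sum_i \sum_j (v k 0 i * v k 0 j) *: christoffel G (f y) i j) h (f y).
have : \sum_k H k + \sum_k L (\sum_i \sum_j (w k 0 i * w k 0 j) *: cov_derive G f y i j) <= 0.
  rewrite -big_split /=; apply: sumr_le0 => k _.
  rewrite cov_derive_contract -/(v k) /L linearD /= -/(L _) -/(L _) -!LE /H.
  have [_] := ext (w k); have [_ ->] := is_derive2_comp (w k) C2f C2h.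
  rewrite -/(v k); lra.
rewrite sum0 addr0.
(* Positive dimension provides at least one strictly positive term. *)
pose k0 := Ordinal d0; rewrite (bigD1 k0)//=; apply/negP; rewrite -ltNge.
apply: ltr_wpDr; last exact: Hpos.
by apply: sumr_ge0 => k _; apply/ltW/Hpos.
Unshelve. all: by end_near. Qed.

End MaximumPrinciple.

(** * Sign of the Hessian *)

Section Potential.
Variable R : realType.
Implicit Types x y u v W : 'rV[R]_3.

Definition dot3 u v : R := \sum_a u 0 a * v 0 a.

(** Indices are kept in the form [0], [1], [1 + 1], which matches the cyclic shifts in [hodge_star3]
    and [cross3]. *)
Lemma sum_ord3 (F : 'I_3 -> R) : \sum_a F a = F 0 + F 1 + F (1 + 1).
Proof. by rewrite !big_ord_recl big_ord0 addr0 addrA; congr (F _ + F _ + F _); apply: val_inj. Qed.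

Lemma ord3_wrap : 1 + 1 + 1 = 0 :> 'I_3. Proof. exact: val_inj. Qed.

(** Both sides are the scalar triple product of [g], [u] and [v]. *)
Lemma hodge_star3_contract (g : 'I_3 -> R) u v :
  \sum_a \sum_b u 0 a * hodge_star3 g a b * v 0 b =
  \sum_a g a * (u 0 (a + 1) * v 0 (a + 1 + 1) - u 0 (a + 1 + 1) * v 0 (a + 1)).
Proof.
rewrite !sum_ord3 !mxE /= !add0r !ord3_wrap !add0r.
ring.
Qed.

Definition cross3 u v (a : 'I_3) : R :=
  u 0 (a + 1) * v 0 (a + 1 + 1) - u 0 (a + 1 + 1) * v 0 (a + 1).

Definition det3 u v w : R := \sum_a u 0 a * cross3 v w a.

Lemma enorm_ge0 n (u : 'rV[R]_n) : 0 <= enorm u.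
Proof. exact: sqrtr_ge0. Qed.

Lemma sqr_enorm n (u : 'rV[R]_n) : enorm u ^+ 2 = \sum_a u 0 a ^+ 2.
Proof. by rewrite sqr_sqrtr// sumr_ge0// => a _; exact: sqr_ge0. Qed.

Lemma enorm_gt0 n (u : 'rV[R]_n) : (0 < enorm u) = (u != 0).
Proof.
rewrite lt0r enorm_ge0 andbT -sqrf_eq0 sqr_enorm; congr negb.
rewrite psumr_eq0 => [|a _]; last exact: sqr_ge0.
apply/allP/eqP => [u0|-> a _]; last by rewrite mxE expr0n /= eqxx.
by apply/rowP => a; rewrite mxE; apply/eqP; rewrite -sqrf_eq0; apply: (u0 a (mem_index_enum a)).
Qed.

Lemma dot3_cauchy u v : `|dot3 u v| <= enorm u * enorm v.
Proof.
rewrite -ler_sqr ?nnegrE ?normr_ge0 ?mulr_ge0 ?enorm_ge0//.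
rewrite real_normK ?num_real// exprMn !sqr_enorm /dot3 !sum_ord3 -subr_ge0.
set a := u 0 0; set b := u 0 1; set c := u 0 (1 + 1).
set a' := v 0 0; set b' := v 0 1; set c' := v 0 (1 + 1).
(* Lagrange's identity. *)
have -> : (a ^+ 2 + b ^+ 2 + c ^+ 2) * (a' ^+ 2 + b' ^+ 2 + c' ^+ 2) - (a * a' + b * b' + c * c') ^+ 2 =
  (a * b' - b * a') ^+ 2 + (a * c' - c * a') ^+ 2 + (b * c' - c * b') ^+ 2 by ring.
by rewrite !addr_ge0 ?sqr_ge0.
Qed.

(** Cauchy-Schwarz for [u] and the cross product of [v] and [w], whose squared length is the product
    of the squared lengths minus the squared inner product. *)
Lemma det3_hadamard u v w : `|det3 u v w| <= enorm u * (enorm v * enorm w).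
Proof.
pose c : 'rV[R]_3 := \row_a cross3 v w a.
have -> : det3 u v w = dot3 u c by apply: eq_bigr => a _; rewrite mxE.
apply: le_trans (dot3_cauchy _ _) _; apply: ler_wpM2l; first exact: enorm_ge0.
rewrite -ler_sqr ?nnegrE ?mulr_ge0 ?enorm_ge0// exprMn !sqr_enorm.
rewrite !sum_ord3 !mxE /cross3.
rewrite !add0r !ord3_wrap !add0r -subr_ge0.
set a := v 0 0; set b := v 0 1; set d := v 0 (1 + 1).
set a' := w 0 0; set b' := w 0 1; set d' := w 0 (1 + 1).
by rewrite (_ : _ - _ = (a * a' + b * b' + d * d') ^+ 2) ?sqr_ge0//; ring.
Qed.

(** The right-hand side of the Hessian formula, with potential and gradient as separate arguments:
    it is jointly linear in the two and can be split over the poles. *)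
Definition gh_quad (phi : R) (g : 'I_3 -> R) x W (al : R) : R :=
  2 * phi * (\sum_a W 0 a ^+ 2)
  - 2 * al * (\sum_a \sum_b W 0 a * hodge_star3 g a b * x 0 b)
  - 2 * (\sum_a g a * W 0 a) * (\sum_a x 0 a * W 0 a)
  - (\sum_a g a * x 0 a) * al ^+ 2 + (\sum_a g a * x 0 a) * \sum_a W 0 a ^+ 2.

Lemma gh_quadE phi g x W al : gh_quad phi g x W al =
  2 * phi * enorm W ^+ 2 + \sum_a g a * (enorm W ^+ 2 * x 0 a - al ^+ 2 * x 0 a
    - 2 * al * cross3 W x a - 2 * dot3 x W * W 0 a).
Proof. rewrite /gh_quad hodge_star3_contract -!sqr_enorm /dot3 /cross3 !sum_ord3; ring. Qed.

Lemma gh_quad_sum n m (c : 'I_n -> R) (g : 'I_n -> 'I_3 -> R) x W al :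
  gh_quad (m + \sum_i c i) (fun a => \sum_i g i a) x W al =
  2 * m * enorm W ^+ 2 + \sum_i gh_quad (c i) (g i) x W al.
Proof.
under [in RHS]eq_bigr do rewrite gh_quadE.
rewrite gh_quadE big_split /= exchange_big /= mulrDr mulrDl mulr_sumr mulr_suml -addrA.
by congr (_ + (_ + _)); apply: eq_bigr => a _; rewrite mulr_suml.
Qed.

(** The contribution of one pole [p], with [y = x - p], freed of the positive factor
    [(2 * enorm y ^+ 3)^-1]. *)
Definition pole_quad y x W (al : R) : R :=
  2 * enorm y ^+ 2 * enorm W ^+ 2 + 2 * al * det3 y W x + 2 * dot3 y W * dot3 x W
  + dot3 y x * (al ^+ 2 - enorm W ^+ 2).

Lemma gh_quad_pole y x W al : y != 0 ->
  gh_quad (2 * enorm y)^-1 (fun a => - (y 0 a / (2 * enorm y ^+ 3))) x W al =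
  (2 * enorm y ^+ 3)^-1 * pole_quad y x W al.
Proof.
rewrite -enorm_gt0 => /lt0r_neq0 y0.
by rewrite gh_quadE /pole_quad /dot3 /det3 !sum_ord3; field.
Qed.

Lemma enorm_triangle u v : enorm u <= enorm (v - u) + enorm v.
Proof.
rewrite -ler_sqr ?nnegrE ?addr_ge0 ?enorm_ge0//.
have := dot3_cauchy (v - u) v; rewrite ler_norml => /andP[+ _].
set s := enorm (v - u); set q := enorm v => h.
suff -> : enorm u ^+ 2 = s ^+ 2 + q ^+ 2 - 2 * dot3 (v - u) v by lra.
by rewrite !sqr_enorm /dot3 !sum_ord3 !mxE; ring.
Qed.

(** Cauchy-Schwarz and Hadamard, combined in the first bound with
    [2 * |al| * w <= al ^+ 2 + w ^+ 2]. *)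
Lemma pole_cross_terms y x W al : let s := enorm y in let q := enorm x in let w := enorm W in
  [/\ - (s * q * (al ^+ 2 + w ^+ 2)) <= 2 * al * det3 y W x,
      - (s * q * w ^+ 2) <= dot3 y W * dot3 x W
    & - (s * q * (al ^+ 2 + w ^+ 2)) <= dot3 y x * (al ^+ 2 - w ^+ 2)].
Proof.
move=> s q w.
have s0 : 0 <= s := enorm_ge0 _; have q0 : 0 <= q := enorm_ge0 _; have w0 : 0 <= w := enorm_ge0 _.
split; apply: lerNnormlW; rewrite !normrM.
- rewrite (ger0_norm (_ : 0 <= 2))//.
  apply: le_trans (_ : 2 * `|al| * (s * (w * q)) <= _).
    by rewrite ler_wpM2l ?mulr_ge0//; exact: det3_hadamard.
  rewrite (_ : _ * (s * _) = s * q * (2 * `|al| * w)); last by ring.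
  rewrite ler_wpM2l ?mulr_ge0// -[al ^+ 2]real_normK ?num_real// -subr_ge0.
  by rewrite (_ : _ - _ = (`|al| - w) ^+ 2) ?sqr_ge0//; ring.
- rewrite (_ : s * q * w ^+ 2 = (s * w) * (q * w)); last by ring.
  by apply: ler_pM => //; exact: dot3_cauchy.
- apply: ler_pM => //; first exact: dot3_cauchy.
  by rewrite ler_norml; have := sqr_ge0 al; have := sqr_ge0 w; lra.
Qed.

(** Write [x = y + p]. The [y] part gives [s ^+ 2 * (al ^+ 2 + w ^+ 2)] plus twice a square, and the
    [p] part costs at most [4 * s * q * (al ^+ 2 + w ^+ 2)]; hence the threshold [4 * q < s]. *)
Lemma pole_quad_far p x W al : 4 * enorm p < enorm (x - p) -> 0 < al ^+ 2 + enorm W ^+ 2 ->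
  0 < pole_quad (x - p) x W al.
Proof.
set y := x - p; have xE a : x 0 a = y 0 a + p 0 a by rewrite !mxE subrK.
rewrite /pole_quad; set s := enorm y; set q := enorm p; set w := enorm W => qs N0.
have -> : det3 y W x = det3 y W p by rewrite /det3 /cross3 !sum_ord3 !xE !add0r !ord3_wrap !add0r; ring.
have -> : dot3 x W = dot3 y W + dot3 p W by rewrite /dot3 !sum_ord3 !xE; ring.
have -> : dot3 y x = s ^+ 2 + dot3 y p by rewrite sqr_enorm /dot3 !sum_ord3 !xE; ring.
have /= [] := pole_cross_terms y p W al; rewrite -/s -/q -/w => h1 h2 h3.
have s0 : 0 <= s := enorm_ge0 _; have q0 : 0 <= q := enorm_ge0 _.
have h4 : 0 < s * (s - 4 * q) * (al ^+ 2 + w ^+ 2).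
  by rewrite !mulr_gt0// ?subr_gt0// (le_lt_trans _ qs)// mulr_ge0.
have := sqr_ge0 (dot3 y W); have := mulr_ge0 (mulr_ge0 s0 q0) (sqr_ge0 al).
lra.
Qed.

Lemma pole_quad_ge y x W al :
  - (4 * enorm y * enorm x * (al ^+ 2 + enorm W ^+ 2)) <= pole_quad y x W al.
Proof.
rewrite /pole_quad; set s := enorm y; set q := enorm x; set w := enorm W.
have /= [] := pole_cross_terms y x W al; rewrite -/s -/q -/w => h1 h2 h3.
have s0 : 0 <= s := enorm_ge0 _; have q0 : 0 <= q := enorm_ge0 _.
have := mulr_ge0 (mulr_ge0 s0 q0) (sqr_ge0 al).
have := mulr_ge0 (sqr_ge0 s) (sqr_ge0 w).
lra.
Qed.

(** For a pole at the origin [y = x]: the determinant vanishes, and the inner products combine into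
    the left side plus twice a square. *)
Lemma pole_quad_center x W al :
  enorm x ^+ 2 * (al ^+ 2 + enorm W ^+ 2) <= pole_quad x x W al.
Proof.
rewrite /pole_quad.
have -> : det3 x W x = 0 by rewrite /det3 /cross3 !sum_ord3 !add0r !ord3_wrap !add0r; ring.
have -> : dot3 x x = enorm x ^+ 2 by rewrite sqr_enorm /dot3; under eq_bigr do rewrite -expr2.
have := sqr_ge0 (dot3 x W); lra.
Qed.

(** * Derivatives of the norm and of the potential, and positivity far from and near the origin *)

Lemma differentiable_sqnorm (y : 'rV[R]_3) :
  differentiable (fun z : 'rV[R]_3 => \sum_a z 0 a ^+ 2) y.
Proof.
have -> : (fun z : 'rV[R]_3 => \sum_a z 0 a ^+ 2) = \sum_a (fun z : 'rV[R]_3 => z 0 a) ^+ 2.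
  by apply/funext => z; rewrite fct_sumE.
apply: differentiable_sum => a; apply: differentiableX.
exact: differentiable_coord.
Qed.

Lemma differentiable_enorm (y : 'rV[R]_3) : y != 0 -> differentiable (@enorm R 3) y.
Proof.
rewrite -enorm_gt0 => y0.
apply: (differentiable_comp (differentiable_sqnorm y) (g := Num.sqrt)).
apply/derivable1_diffP; apply: ex_derive; apply: is_derive1_sqrt.
by rewrite -sqr_enorm exprn_gt0.
Qed.

(** Obtained by differentiating the square of the norm in two ways and dividing by the norm. *)
Lemma derive_enorm (y v : 'rV[R]_3) : y != 0 -> 'D_v (@enorm R 3) y = dot3 y v / enorm y.
Proof.
move=> y0; have dy := differentiable_enorm y0; have := lt0r_neq0; rewrite -enorm_gt0 in y0 => /(_ _ _ y0) yn0.
have dv : is_derive y v (@enorm R 3) ('D_v (@enorm R 3) y) by exact/derivableP/diff_derivable.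
have h1 := is_deriveM dv dv.
have h2 : is_derive y v (fun z : 'rV[R]_3 => \sum_a z 0 a * z 0 a)
    (\sum_a (v 0 a * y 0 a + y 0 a * v 0 a)).
  have hid a : is_derive y v (fun z : 'rV[R]_3 => z 0 a) (v 0 a).
    have := @is_derive_coord R _ _ _ id 0 a y v; rewrite derive_id; apply.
    exact: derivable_id.
  exact: is_derive_sum_mul.
have E : (@enorm R 3) * (@enorm R 3) = (fun z : 'rV[R]_3 => \sum_a z 0 a * z 0 a).
  by apply/funext => z; rewrite fctE -expr2 sqr_enorm; apply: eq_bigr => a _; rewrite expr2.
rewrite E in h1; case: h1 => _; case: h2 => _ ->; rewrite /dot3 /GRing.scale /= => h; apply: (mulIf yn0); rewrite divfK//.
have : 2 * \sum_a y 0 a * v 0 a = \sum_a (v 0 a * y 0 a + y 0 a * v 0 a).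
  by rewrite mulr_sumr; apply: eq_bigr => a _; ring.
by rewrite h mulrC; lra.
Qed.

Lemma gh_potential_derive k m (p : 'I_k -> 'rV[R]_3) x : (forall i, x <> p i) ->
  differentiable (gh_potential m p) x /\ forall a, partial a (gh_potential m p) x =
    \sum_i - ((x - p i) 0 a / (2 * enorm (x - p i) ^+ 3)).
Proof.
move=> xp; have y0 i : x - p i != 0 by rewrite subr_eq0; apply/eqP.
pose t i : 'rV[R]_3 -> R := fun z => (2 * enorm (z - p i))^-1.
have E : gh_potential m p = cst m + \sum_i t i.
  by apply/funext => z; rewrite fctE fct_sumE.
have dsub i : differentiable (fun z : 'rV[R]_3 => z - p i) x by exact: ex_diff.
have dn i : differentiable (fun z => enorm (z - p i)) x.
  exact: (differentiable_comp (dsub i) (differentiable_enorm (y0 i))).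
have d2n i : differentiable (fun z => 2 * enorm (z - p i)) x.
  exact: (differentiableZ 2 (dn i)).
have n0 i : 2 * enorm (x - p i) != 0 by rewrite mulf_neq0// lt0r_neq0// enorm_gt0.
have dt i : differentiable (t i) x by apply: differentiableV.
split; first by rewrite E; apply: differentiableD => //; exact: differentiable_sum.
move=> a; rewrite E /partial deriveD//; last by apply/diff_derivable/differentiable_sum.
rewrite derive_cst add0r derive_sum => [|i]; last exact: diff_derivable.
apply: eq_bigr => i _.
have Dn : 'D_(delta_mx 0 a) (fun z => enorm (z - p i)) x = (x - p i) 0 a / enorm (x - p i).
  have [_ h] := is_derive_comp (delta_mx 0 a) (dsub i) (differentiable_enorm (y0 i)).
  apply: etrans h _; rewrite (deriveE _ (dsub i)) diff_val.
  have -> : (id - 0 : 'rV[R]_3 -> 'rV[R]_3) (delta_mx 0 a) = delta_mx 0 a.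
    by rewrite !fctE subr0.
  rewrite derive_enorm//; congr (_ / _); rewrite /dot3 (bigD1 a)//= big1 ?addr0 => [|b ba].
    by rewrite [delta_mx _ _ _ _]mxE !eqxx mulr1.
  by rewrite [delta_mx _ _ _ _]mxE (negPf ba) andbF mulr0.
have D2 : 'D_(delta_mx 0 a) (fun z => 2 * enorm (z - p i)) x =
    2 * ((x - p i) 0 a / enorm (x - p i)).
  exact: etrans (deriveZ 2 (diff_derivable (dn i))) (congr1 ( *%R 2) Dn).
pose dn2 z : R := 2 * enorm (z - p i).
have dv := @deriveV R _ dn2 x (delta_mx 0 a) (n0 i) (diff_derivable (d2n i)).
apply: etrans dv _.
apply: etrans (congr1 ( *%R (- dn2 x ^- 2)) D2) _; rewrite /dn2.
have en0 : enorm (x - p i) != 0 by rewrite lt0r_neq0// enorm_gt0.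
move: (enorm _) en0 ((x - p i) 0 a) => s s0 c; field.
exact: s0.
Qed.

(** The constant [m] contributes a nonnegative term, possibly zero, and every pole a positive one;
    strictness comes from having at least one pole. *)
Lemma far_quad_gt0 k m (p : 'I_k -> 'rV[R]_3) x W al : (0 < k)%N -> 0 <= m ->
  (forall i, 4 * enorm (p i) < enorm (x - p i)) -> 0 < al ^+ 2 + enorm W ^+ 2 ->
  0 < gh_quad (gh_potential m p x)
    (fun a => \sum_i - ((x - p i) 0 a / (2 * enorm (x - p i) ^+ 3))) x W al.
Proof.
move=> k0 m0 far N0; rewrite gh_quad_sum.
have y0 i : 0 < enorm (x - p i) by rewrite (le_lt_trans _ (far i))// mulr_ge0// enorm_ge0.
have t0 i : 0 < gh_quad (2 * enorm (x - p i))^-1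
    (fun a => - ((x - p i) 0 a / (2 * enorm (x - p i) ^+ 3))) x W al.
  rewrite gh_quad_pole -?enorm_gt0// mulr_gt0//; last exact: pole_quad_far.
  by rewrite invr_gt0 mulr_gt0// exprn_gt0.
rewrite ltr_wpDl//; first by rewrite mulr_ge0 ?sqr_ge0// mulr_ge0.
rewrite (bigD1 (Ordinal k0))//= ltr_wpDr//.
by apply: sumr_ge0 => i _; exact: ltW.
Qed.

(** With [r = enorm x], the pole at the origin contributes at least [N / (2 * r)], every other pole
    at least [- 8 * r / del ^+ 2 * N], and the bound on [r] makes the first outweigh all the others
    together. *)
Lemma near_quad_gt0 k m (p : 'I_k -> 'rV[R]_3) i0 (del : R) x W al : 0 <= m ->
  p i0 = 0 -> 0 < del -> (forall j, j != i0 -> del <= enorm (p j)) ->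
  x != 0 -> enorm x < del / (4 * k%:R) -> 0 < al ^+ 2 + enorm W ^+ 2 ->
  0 < gh_quad (gh_potential m p x)
    (fun a => \sum_i - ((x - p i) 0 a / (2 * enorm (x - p i) ^+ 3))) x W al.
Proof.
move=> m0 p0 del0 delP x0 xdel N0; rewrite gh_quad_sum.
set N := al ^+ 2 + enorm W ^+ 2 in N0 *; set r := enorm x in xdel *.
have r0 : 0 < r by rewrite enorm_gt0.
have k1 : (1 : R) <= k%:R by rewrite ler1n; case: (k) i0 {p0 delP} => [[]|].
have k0 : (0 : R) < k%:R by rewrite (lt_le_trans _ k1).
have rk : 4 * k%:R * r < del by move: xdel; rewrite ltr_pdivlMr ?mulr_gt0// mulrC.
rewrite ltr_wpDl//; first by rewrite mulr_ge0 ?sqr_ge0// mulr_ge0.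
rewrite (bigD1 i0)//= p0 subr0 gh_quad_pole -/r//.
have h0 : (2 * r)^-1 * N <= (2 * r ^+ 3)^-1 * pole_quad x x W al.
  rewrite (_ : (2 * r)^-1 * N = (2 * r ^+ 3)^-1 * (r ^+ 2 * N)); last by field; exact: lt0r_neq0.
  by rewrite ler_wpM2l ?pole_quad_center// invr_ge0 mulr_ge0// exprn_ge0// ltW.
have hj j : j != i0 -> - (8 * r / del ^+ 2 * N) <= gh_quad (2 * enorm (x - p j))^-1
    (fun a => - ((x - p j) 0 a / (2 * enorm (x - p j) ^+ 3))) x W al.
  move=> ji; have del_j := delP j ji.
  (* The triangle inequality with [r <= k%:R * r < del / 4] keeps [x] at distance at least [del / 2]
     from the other poles. *)
  have sj : del <= 2 * enorm (x - p j).
    have := enorm_triangle (p j) x; rewrite -/r.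
    have : r <= k%:R * r by rewrite ler_peMl// ltW.
    lra.
  have s0 : 0 < enorm (x - p j) by lra.
  rewrite gh_quad_pole -?enorm_gt0//; set s := enorm (x - p j) in sj s0 *.
  apply: le_trans (_ : (2 * s ^+ 3)^-1 * (- (4 * s * r * N)) <= _); last first.
    by rewrite ler_wpM2l ?pole_quad_ge// invr_ge0 mulr_ge0// exprn_ge0// ltW.
  rewrite (_ : _ * - _ = - (2 * r / s ^+ 2 * N)); last by field; exact: lt0r_neq0.
  rewrite lerN2 ler_pM2r// (_ : 8 * r / del ^+ 2 = 2 * r / (del / 2) ^+ 2); last first.
    by field; exact: lt0r_neq0.
  rewrite ler_pM2l ?mulr_gt0// lef_pV2 ?posrE ?exprn_gt0// ?divr_gt0//.
  by rewrite ler_sqr ?nnegrE ?(ltW s0) ?divr_ge0 ?(ltW del0)// ler_pdivrMr// mulrC.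
apply: lt_le_trans (_ : 0 < (2 * r)^-1 * N - k%:R * (8 * r / del ^+ 2 * N)) _.
  rewrite (mulrA k%:R) -mulrBl mulr_gt0// subr_gt0 -[ltRHS]div1r ltr_pdivlMr ?mulr_gt0//.
  (* The ratio of the two contributions: the bound on [r] makes the square less than 1, and [k] is
     at least 1. *)
  have -> : k%:R * (8 * r / del ^+ 2) * (2 * r) = (4 * k%:R * r / del) ^+ 2 / k%:R.
    by field; rewrite !lt0r_neq0.
  rewrite ltr_pdivrMr// mul1r; apply: lt_le_trans k1.
  by rewrite expr_lt1// ?ltr_pdivrMr ?mul1r// divr_ge0 ?mulr_ge0 ?ltW.
apply: lerD => //.
apply: le_trans (ler_sum _ hj).
rewrite sumr_const -[leRHS]mulr_natl mulrN lerN2 ler_wpM2r//.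
  by rewrite mulr_ge0 ?divr_ge0 ?mulr_ge0 ?exprn_ge0 ?ltW.
by rewrite ler_nat (leq_trans (max_card _))// card_ord.
Qed.

End Potential.

(** * Compact minimal submanifolds *)

Section GHSpaces.
Variable R : realType.

Lemma chart_near n (M : smoothManifold R n) (c : chart R M n) (p : M) :
  cdom c p -> \forall z \near cmap c p, cdom c (cinv c z) /\ cmap c (cinv c z) = z.
Proof.
move=> cp; have : nbhs (cmap c p) (cmap c @` cdom c).
  by apply: open_nbhs_nbhs; split; [exact: cimage_open|exists p].
by apply: filterS => z [q cq <-]; rewrite cmapK.
Qed.

(** [cinv c] inverts [cmap c] only on [cdom c]; continuity of [F] keeps the nearby image points
    inside that domain. *)
Lemma in_charts_near d n (N : smoothManifold R d) (M : smoothManifold R n)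
    (F : N -> M) a c q : continuous F -> cdom a q -> cdom c (F q) ->
  \forall y \near cmap a q, cinv c (in_charts F a c y) = F (cinv a y).
Proof.
move=> cF aq cq.
have : nbhs (F (cinv a (cmap a q))) (cdom c).
  by rewrite cmapK//; apply: open_nbhs_nbhs; split => //; exact: cdom_open.
move=> /cF /(cinv_continuous aq) cn.
have {cn} : \forall y \near cmap a q, cdom c (F (cinv a y)) by exact: cn.
by apply: filterS => y cy; rewrite /in_charts /= cmapK.
Qed.

Lemma open_avoid_points n k (p : 'I_k -> 'rV[R]_n) : open [set x | forall i, x <> p i].
Proof.
rewrite openE => x xp.
suff : \forall z \near x, forall i, z <> p i by [].
apply: (@filter_forall _ _ (fun i z => z <> p i) (nbhs x)) => i.
have : open (~` [set p i]).
  apply/closed_openC/accessible_closed_set1/hausdorff_accessible/norm_hausdorff.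
by rewrite openE; apply; exact: xp.
Qed.

Lemma sqnorm_max d (N : smoothManifold R d) (f : N -> 'rV[R]_3) :
  [set: N] !=set0 -> compact [set: N] -> continuous f ->
  exists q, forall q', enorm (f q') <= enorm (f q).
Proof.
move=> N0 cN cf; pose h q := \sum_a f q 0 a ^+ 2.
have ch : continuous h.
  move=> q; apply: (@continuous_comp _ _ _ f (fun x : 'rV[R]_3 => \sum_a x 0 a ^+ 2)).
    exact: cf.
  exact/differentiable_continuous/differentiable_sqnorm.
have [q _ qmax] := compact_EVT_max N0 cN (continuous_subspaceT ch).
by exists q => q'; apply: ler_wsqrtr; apply: qmax; rewrite inE.
Qed.

Variable X : ghSpace R.

Lemma gh_phi_gt0 x : gh_U X x -> 0 < gh_phi X x.
Proof.
move=> Ux; rewrite /gh_phi /gh_potential ltr_wpDl ?gh_m_ge0//.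
have t0 i : 0 < (2 * enorm (x - gh_p (g := X) i))^-1.
  by rewrite invr_gt0 mulr_gt0// enorm_gt0 subr_eq0; apply/eqP/Ux.
rewrite (bigD1 (Ordinal (gh_k_gt0 X)))//= ltr_wpDr//.
by apply: sumr_ge0 => i _; exact: ltW.
Qed.

(** Transfers the chart computations to a point where the norm of the projection is maximal: the
    vector on which the Hessian is nonpositive yields [W] and [al]. *)
Lemma minimal_max_quad d (N : smoothManifold R d) (F : N -> X) q :
  (0 < d)%N -> minimal_immersion (@gh_metric R X) F ->
  (forall q', enorm (gh_pi (F q')) <= enorm (gh_pi (F q))) ->
  gh_U X (gh_pi (F q)) ->
  let x := gh_pi (F q) in
  exists W al, 0 < al ^+ 2 + enorm W ^+ 2 /\
    gh_quad (gh_phi X x)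
      (fun a => \sum_i - ((x - gh_p i) 0 a / (2 * enorm (x - gh_p (g := X) i) ^+ 3))) x W al <= 0.
Proof.
move=> d0 [[[cF smF] rkF] minF] qmax Ux x.
have [a Aa aq] := atlas_cover q; have [c Ac cq] := atlas_cover (F q).
have caq : chart_at a q by []; have ccq : chart_at c (F q) by [].
pose f := in_charts F a c; pose y := cmap a q.
have fy : f y = cmap c (F q) by rewrite /f /in_charts /= cmapK.
pose P := @gh_pi R X \o cinv c.
have Pz : P (f y) = x by rewrite /P /= fy cmapK.
have C2f : C2_at f y by apply: smooth_at_C2; exact: smF.
have C2P : C2_at P (f y).
  by apply: smooth_at_C2; rewrite fy; have [+ _] := gh_bundle X => /(_ _ Ux); apply.
have X0q : @gh_X0 R X (F q) by [].
have [[smeta _] _ _] := gh_etaP X.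
have de : differentiable (@gh_eta R X c) (f y).
  by rewrite fy; have /nbhs_singleton/(_ [::]) := smeta _ _ X0q ccq.
have [smg _ symg posg] := gh_metricP X.
have dG : differentiable (@gh_metric R X c) (f y).
  by rewrite fy; have /nbhs_singleton/(_ [::]) := smg _ _ ccq.
have [dphi gradphi] := gh_potential_derive (gh_m X) Ux.
have phi0 := gh_phi_gt0 Ux.
(* The formula for the metric is available only over [gh_U]; openness of [gh_U] makes it hold on a
   neighbourhood, so that it can be differentiated. *)
have UP : \forall z \near f y, gh_U X (P z).
  have : nbhs (P (f y)) (gh_U X).
    by apply: open_nbhs_nbhs; split; [exact: open_avoid_points|rewrite Pz].
  by apply: (differentiable_continuous (nbhs_singleton C2P.1)).
have GE : \forall z \near f y, @gh_metric R X c z =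
    (gh_phi X (P z))^-1 *: (@gh_eta R X c z *m (@gh_eta R X c z)^T) +
    gh_phi X (P z) *: (jacobian P z *m (jacobian P z)^T).
  have cn := chart_near cq; rewrite -fy in cn.
  apply: filterS2 cn UP => z [cz zE] Uz.
  have := @gh_metricE R X (cinv c z) c Uz (conj Ac cz).
  by rewrite zE.
have posG (v : 'rV[R]_4) : v != 0 -> 0 < (v *m @gh_metric R X c (f y) *m v^T) 0 0.
  by move=> v0; rewrite fy; exact: (posg (F q) c v ccq v0).
have symG : (@gh_metric R X c (f y))^T = @gh_metric R X c (f y) by rewrite fy; exact: (symg (F q) c ccq).
have Gunit : @gh_metric R X c (f y) \in unitmx.
  rewrite unitmxE unitfE; apply/negP => /det0P[v v0 vG].
  by have := posG v v0; rewrite vG mul0mx mxE ltxx.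
have mono : dform (@gh_eta R X c) (f y) =
    jacobian P (f y) *m hodge_star3 (fun a => partial a (gh_phi X) (P (f y))) *m
    (jacobian P (f y))^T.
  by rewrite Pz fy; exact: (@gh_monopole R X (F q) c X0q ccq).
have hmax : \forall y' \near y, sqnorm_at P (f y') <= sqnorm_at P (f y).
  apply: filterS (in_charts_near cF aq cq) => y' fy'.
  rewrite /sqnorm_at -!sqr_enorm ler_sqr ?nnegrE ?enorm_ge0// Pz.
  by rewrite /P /= fy'; exact: qmax.
have dphiP : differentiable (gh_phi X) (P (f y)) by rewrite Pz.
have phiP0 : 0 < gh_phi X (P (f y)) by rewrite Pz.
have [v v0 Hv] := minimal_hessian_at_max C2f (C2_sqnorm_at C2P) symG posG
  (rkF _ _ _ caq ccq) d0 (minF _ _ _ caq ccq) hmax.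
(* [W] is the projection of [v], and [al] is the connection form on [v] divided by the potential. If
   both vanished, the metric would vanish on [v]. *)
exists ('D_v P (f y)), ((gh_phi X x)^-1 * (v *m @gh_eta R X c (f y)) 0 0).
have sumE : \sum_a 'D_v P (f y) 0 a * 'D_v P (f y) 0 a = enorm ('D_v P (f y)) ^+ 2.
  by rewrite sqr_enorm; apply: eq_bigr => b _; rewrite expr2.
split.
  have := posG v v0; rewrite (nbhs_singleton (gh_form_near C2P GE v v)) Pz.
  rewrite ltNge => N0; rewrite lt0r addr_ge0 ?sqr_ge0// andbT.
  apply: contra N0; rewrite paddr_eq0 ?sqr_ge0// !sqrf_eq0 mulf_eq0 invr_eq0 gt_eqF//=.
  move=> /andP[/eqP -> /eqP w0]; rewrite mul0r mulr0 add0r.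
  by rewrite sumE w0 expr0n mulr0.
have := gh_hessian C2P de dG dphiP phiP0 GE mono Gunit v.
rewrite /= Pz => HE.
have <- : (fun a => partial a (gh_phi X) x) = (fun a =>
    \sum_i - ((x - gh_p i) 0 a / (2 * enorm (x - gh_p (g := X) i) ^+ 3))).
  by apply/funext => b; exact: gradphi.
have -> := esym HE : gh_quad _ _ _ _ _ = _.
by rewrite pmulr_rle0.
Qed.

End GHSpaces.

(** * The constant [C], and the two conclusions on compact minimal submanifolds *)

Lemma enorm_distC (R : realType) n (u v : 'rV[R]_n) : enorm (u - v) = enorm (v - u).
Proof.
by rewrite /enorm; congr Num.sqrt; apply: eq_bigr => a _; rewrite !mxE -sqrrN opprB.
Qed.

(** The intermediate value theorem on an interval of length 1/200 ending at 5.07 gives the root and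
    its approximation. Dividing by [x - C] leaves a quadratic of negative discriminant, whence
    uniqueness. The bound [5 <= C] is what the geometric estimate uses. *)
Lemma cubic_root (R : realType) : exists C : R,
  [/\ forall x : R, root (- 'X^3 + 4 *: 'X^2 + 5 *: 'X + 2%:P : {poly R}) x <-> x = C,
      `|C - 507 / 100| < 1 / 200 & 5 <= C].
Proof.
pose q : {poly R} := 'X^3 - 4 *: 'X^2 - 5 *: 'X - 2%:P.
have qE x : q.[x] = x ^+ 3 - 4 * x ^+ 2 - 5 * x - 2 by rewrite /q !(hornerD, hornerN, hornerZ, hornerXn, hornerX, hornerC).
have [||C /andP[C1 C2] Cr] := @poly_ivt R q (5065 / 1000) (507 / 100).
- lra.
- by rewrite !qE; apply/andP; split; lra.
have C0 : C ^+ 3 - 4 * C ^+ 2 - 5 * C - 2 = 0 by rewrite -qE; exact/eqP.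
(* Excluding the left endpoint makes the approximation bound strict. *)
have C3 : C != 5065 / 1000.
  by apply/eqP => CE; rewrite CE in C0; lra.
have C3' : 5065 / 1000 < C by rewrite lt_neqAle eq_sym C3.
exists C; split; last lra; last by rewrite ltr_norml; apply/andP; split; lra.
move=> x; rewrite rootE.
have -> : (- 'X^3 + 4 *: 'X^2 + 5 *: 'X + 2%:P : {poly R}).[x] =
    - (x ^+ 3 - 4 * x ^+ 2 - 5 * x - 2).
  by rewrite !(hornerD, hornerN, hornerZ, hornerXn, hornerX, hornerC); ring.
rewrite oppr_eq0; split => [/eqP x0|->]; last by rewrite C0.
have : (x - C) * (x ^+ 2 + (C - 4) * x + (C ^+ 2 - 4 * C - 5)) = 0.
  transitivity (x ^+ 3 - 4 * x ^+ 2 - 5 * x - 2 - (C ^+ 3 - 4 * C ^+ 2 - 5 * C - 2)); first by ring.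
  by rewrite x0 C0 subrr.
move=> /eqP; rewrite mulf_eq0 => /orP[|/eqP h]; first by rewrite subr_eq0 => /eqP.
have := sqr_ge0 (x + (C - 4) / 2); nra.
Qed.

Section MainResults.
Variables (R : realType) (X : ghSpace R).

(** If the maximal norm exceeded [5 * M], then each pole would satisfy [|x - p_i| >= |x| - |p_i| > 4
    * M >= 4 * |p_i|], and the quadratic form would be positive there. *)
Lemma minimal_far d (N : smoothManifold R d) (F : N -> X) (C : R) :
  5 <= C -> (0 < d)%N -> compact_minimal_submanifold (@gh_metric R X) F ->
  forall q, enorm (gh_pi (F q)) <= C * max_norm_singular X.
Proof.
move=> C5 d0 [N0 cN minF] q'; have [[[cF _] _] _] := minF.
have cpiF : continuous (@gh_pi R X \o F).
  by move=> q; apply: continuous_comp; [exact: cF|exact: gh_pi_continuous].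
have [q qmax] := sqnorm_max N0 cN cpiF; rewrite /= in qmax.
apply: le_trans (qmax q') _; rewrite leNgt; apply/negP => far.
set x := gh_pi (F q) in far; set M := max_norm_singular X in far.
have pM i : enorm (gh_p (g := X) i) <= M.
  exact: (le_bigmax _ (fun i => enorm (gh_p (g := X) i)) i).
have M0 : 0 <= M by apply: le_trans (pM (Ordinal (gh_k_gt0 X))); exact: enorm_ge0.
have xM : 5 * M < enorm x by apply: le_lt_trans far; rewrite ler_wpM2r.
have Ux : gh_U X x by move=> i xp; have := pM i; rewrite -xp; lra.
have [W [al [N1]]] := minimal_max_quad d0 minF qmax Ux.
apply/negP; rewrite -ltNge -/x; apply: far_quad_gt0 => //.
- exact: gh_k_gt0.
- exact: gh_m_ge0.
- move=> i; have := enorm_triangle x (gh_p i); rewrite enorm_distC.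
  have := pM i; lra.
Qed.

Lemma minimal_near d (N : smoothManifold R d) (F : N -> X) i0 (del : R) :
  gh_p (g := X) i0 = 0 -> 0 < del -> (forall j, j != i0 -> del <= enorm (gh_p (g := X) j)) ->
  (0 < d)%N -> compact_minimal_submanifold (@gh_metric R X) F ->
  ~ (forall q, enorm (gh_pi (F q)) < del / (4 * (gh_k X)%:R)).
Proof.
move=> p0 del0 delP d0 [N0 cN minF] near0; have [[[cF _] rkF] _] := minF.
have cpiF : continuous (@gh_pi R X \o F).
  by move=> q; apply: continuous_comp; [exact: cF|exact: gh_pi_continuous].
have [q qmax] := sqnorm_max N0 cN cpiF; rewrite /= in qmax.
have k1 : (1 : R) <= (gh_k X)%:R by rewrite ler1n gh_k_gt0.
have [x0|x0] := eqVneq (gh_pi (F q)) 0.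
  have piF0 q' : gh_pi (F q') = 0.
    apply/eqP; rewrite -[_ == _]negbK -enorm_gt0 -leNgt (le_trans (qmax q'))// x0.
    by rewrite leNgt enorm_gt0 eqxx.
  have [pt ptE _] := gh_added i0.
  have Fo q' : F q' = pt.
    have : (@gh_pi R X @^-1` [set gh_p i0]) (F q') by rewrite /= p0 piF0.
    by rewrite ptE.
  have [a Aa aq] := atlas_cover q; have [c Ac cq] := atlas_cover (F q).
  have := rkF q a c (conj Aa aq) (conj Ac cq).
  have -> : in_charts F a c = cst (cmap c pt) by apply/funext => y; rewrite /in_charts /= Fo.
  have -> : jacobian (cst (cmap c pt)) (cmap a q) = 0.
    apply/row_matrixP => i; rewrite row0 rowE -deriveEjacobian; last exact: differentiable_cst.
    by rewrite derive_cst.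
  by rewrite mxrank0 => d0'; rewrite -d0' in d0.
(* The poles other than the origin have norm at least [del], beyond the ball considered. *)
have Ux : gh_U X (gh_pi (F q)).
  move=> j xp; have [ji|ji] := eqVneq j i0; first by rewrite xp ji p0 eqxx in x0.
  have := delP j ji; rewrite -xp; have := near0 q.
  rewrite ltr_pdivlMr ?mulr_gt0 ?(lt_le_trans _ k1)// => h.
  have : enorm (gh_pi (F q)) <= enorm (gh_pi (F q)) * (4 * (gh_k X)%:R).
    by rewrite ler_peMr ?enorm_ge0//; lra.
  lra.
have [W [al [N1]]] := minimal_max_quad d0 minF qmax Ux.
apply/negP; rewrite -ltNge; apply: near_quad_gt0 p0 del0 delP x0 (near0 q) N1.
exact: gh_m_ge0.
Qed.

Lemma nonzero_poles_separated i0 : gh_p (g := X) i0 = 0 ->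
  exists2 del : R, 0 < del & forall j, j != i0 -> del <= enorm (gh_p (g := X) j).
Proof.
(* The default 1 keeps the minimum positive when there is no other pole; otherwise injectivity of
   [gh_p] makes every norm in it positive. *)
move=> p0; exists (\big[Num.min/1]_(j | j != i0) enorm (gh_p (g := X) j)); last first.
  by move=> j ji; exact: bigmin_le_cond.
apply: lt_bigmin => // j ji; rewrite enorm_gt0 -p0; apply: contraNneq ji => pj.
by rewrite (gh_p_inj pj).
Qed.

End MainResults.

Theorem theorem1p4 (R : realType) :
  exists C : R,
  [/\ forall x : R,
        root (- 'X^3 + 4 *: 'X^2 + 5 *: 'X + 2%:P : {poly R}) x <-> x = C,
      `|C - 507 / 100| < 1 / 200
    & forall X : ghSpace R, multi_Eguchi_Hanson X \/ multi_Taub_NUT X ->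
      (forall (d : nat) (N : smoothManifold R d) (F : N -> X),
         (1 <= d <= 3)%N ->
         compact_minimal_submanifold (@gh_metric R X) F ->
         range F `<=`
           @gh_pi R X @^-1` [set x | enorm x <= C * max_norm_singular X]) /\
      ((exists i, @gh_p R X i = 0) ->
       exists2 r0 : R, 0 < r0 &
         ~ exists (d : nat) (N : smoothManifold R d) (F : N -> X),
           [/\ (1 <= d <= 3)%N,
               compact_minimal_submanifold (@gh_metric R X) F
             & range F `<=` @gh_pi R X @^-1` [set x | enorm x < r0]])].
Proof.
have [C [Croot C507 C5]] := cubic_root R; exists C; split => // X _; split.
  move=> d N F /andP[d0 _] cmF _ [q _ <-].
  exact: minimal_far C5 d0 cmF q.
move=> [i0 p0]; have [del del0 delP] := nonzero_poles_separated p0.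
(* The radius below which the pole at the origin dominates in [near_quad_gt0]. *)
exists (del / (4 * (gh_k X)%:R)).
  by rewrite divr_gt0// mulr_gt0// ltr0n gh_k_gt0.
move=> [d [N [F [/andP[d0 _] cmF sub]]]].
apply: minimal_near p0 del0 delP d0 cmF _ => q.
by apply: (sub (F q)); exists q.
Qed.
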